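(* Let $\alpha \geq 1$ and let $\lambda$ be a partition of $n$ chosen from the Jack$_\alpha$ measure, and set \[ T_{n,\alpha}(\lambda) = \frac{\sum_i \left(\alpha\binom{\lambda_i}{2} - \binom{\lambda_i'}{2}\right)}{\sqrt{\alpha\binom{n}{2}}}, \] where $\lambda_i$ and $\lambda_i'$ are the lengths of the $i$-th row and $i$-th column of $\lambda$. Then there is a constant $C_\alpha$ depending only on $\alpha$ such that for all $n \geq 2$ and all real $x_0$, \[ \left| \mathbb{P}\left( T_{n,\alpha}(\lambda) \leq x_0 \right) - \frac{1}{\sqrt{2\pi}} \int_{-\infty}^{x_0} e^{-t^2/2}\, dt \right| \leq C_\alpha n^{-1/2}. \]
   Context: For $\alpha>0$, the Jack$_\alpha$ measure on partitions of $n$ chooses $\lambda$ with probability \[ \frac{\alpha^n n!}{\prod_{x\in\lambda}(\alpha a(x) + l(x) + 1)(\alpha a(x) + l(x) + \alpha)}, \] where for a box $x$, $a(x)$ (the arm) is the number of boxes in the same row as $x$ and to its right, and $l(x)$ (the leg) is the number of boxes in the same column as $x$ and below it. For $\alpha=1$ this is the Plancherel measure of $S_n$. *)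

(* Defs.v *)
From Stdlib Require Import Reals List Arith Lra.
From Coquelicot Require Import Coquelicot.
Import ListNotations.
Open Scope R_scope.

(* A partition is a nonincreasing list of positive naturals (its rows). *)

(* parts fuel m n : all partitions of n with all parts <= m (fuel >= n). *)
Fixpoint parts (fuel m n : nat) : list (list nat) :=
  match fuel with
  | O => if Nat.eqb n 0 then [[]] else []
  | S f => if Nat.eqb n 0 then [[]]
           else flat_map (fun p => map (cons p) (parts f p (n - p)))
                         (seq 1 (Nat.min m n))
  end.

Definition partitions (n : nat) : list (list nat) := parts n n n.

(* Length of the j-th column (0-indexed) of lambda: #{i | lambda_i > j}. *)
Definition col_len (lam : list nat) (j : nat) : nat :=
  length (filter (fun r => Nat.ltb j r) lam).

Definition conjugate (lam : list nat) : list nat :=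
  map (col_len lam) (seq 0 (hd 0%nat lam)).

Definition prodR (l : list R) : R := fold_right Rmult 1 l.
Definition sumR (l : list R) : R := fold_right Rplus 0 l.

(* Box (i,j), 0-indexed row i and column j with j < lambda_i:
   arm = lambda_i - j - 1, leg = lambda'_j - i - 1. *)
Definition hook_product (alpha : R) (lam : list nat) : R :=
  prodR (map (fun i =>
    prodR (map (fun j =>
       let a := INR (nth i lam 0%nat - j - 1) in
       let l := INR (col_len lam j - i - 1) in
       (alpha * a + l + 1) * (alpha * a + l + alpha))
     (seq 0 (nth i lam 0%nat))))
   (seq 0 (length lam))).

Definition jack_weight (alpha : R) (n : nat) (lam : list nat) : R :=
  alpha ^ n * INR (fact n) / hook_product alpha lam.

Definition binom2 (x : nat) : R := INR x * (INR x - 1) / 2.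

Definition T_stat (alpha : R) (n : nat) (lam : list nat) : R :=
  (alpha * sumR (map binom2 lam) - sumR (map binom2 (conjugate lam)))
  / sqrt (alpha * binom2 n).

Definition jack_prob_T_le (alpha : R) (n : nat) (x0 : R) : R :=
  sumR (map (fun lam => if Rle_dec (T_stat alpha n lam) x0
                        then jack_weight alpha n lam else 0)
            (partitions n)).

Definition std_normal_cdf (x0 : R) : R :=
  / sqrt (2 * PI) *
  RInt_gen (fun t => exp (- t ^ 2 / 2)) (Rbar_locally m_infty) (at_point x0).

(* Main.v *)
(* Kerov's growth process adds to a random partition of [n - 1] a box, chosen so that the Jack measure
   on partitions of [n - 1] is carried to the one on partitions of [n]. The numerator of [T] is the sum
   of the alpha-contents of the boxes, hence the sum of the contents X_1, ..., X_n of the added boxes.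
   Interpolation at the contents of the addable boxes shows that, given the past, X_(k+1) has mean 0,
   variance exactly alpha k, and a third moment of order k; moreover all rows and columns are O(sqrt k)
   outside an event of probability O(k^-4).
   Replace the X_k one at a time by Gaussian variables of the same variance, the indicator being
   smoothed by a Gaussian of standard deviation t of order sqrt n. The third moment costs
   n^(-1/2), and the fourth derivative of the normal distribution function is integrated against the
   law of the partial sum, whose concentration at scale at least t is known by induction on n
   for the smoothed distribution function. Choosing t / sqrt n large closes the induction. *)

Require Import Defs.
From Stdlib Require Import Reals List Arith Lra Lia Psatz Permutation.
From Coquelicot Require Import Coquelicot.
Import ListNotations.
Open Scope R_scope.

(** * The normal distribution function *)

(* Coquelicot states equations in algebraic structures over [R], which [ring] does not see. *)
Ltac real_eq := match goal with |- @eq _ ?a ?b => change (@eq R a b) end.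

(** Martingale limit theorems are usually obstructed by a fluctuating conditional variance. Here it
    is the deterministic number [alpha * k], so a Gaussian of the same variance replaces each jump
    whatever the past, and only errors of third and fourth order remain. The third moment depends on
    the shape through the content sum, so it is of order k only on average. The fourth order error
    is the obstacle. At step k it has size k^2 / v^2, where the Gaussian variance v already present
    is at least n (n - k - 1) / 2 + N n. With the supremum of the fourth derivative these errors add
    up to order 1 / N, not n^(-1/2). But that derivative is large only on a window of width sqrt v,
    which the partial sum meets with probability of order sqrt v / n + K / sqrt k, where K is the
    constant sought. The first term sums to n^(-1/2); the second returns K / sqrt n with a factor of
    order 1 / N, which is why a large N closes the induction. The exponent 4 of the rare event is
    forced: there a jump is bounded only by [alpha * k], and the fourth power of this must be
    compensated. *)

Definition gauss (t : R) : R := exp (- t ^ 2 / 2).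
Definition gauss_int (x : R) : R := RInt gauss 0 x.

Lemma continuous_gauss (x : R) : continuous gauss x.
Proof.
  apply (@ex_derive_continuous R_AbsRing R_NormedModule).
  unfold gauss. auto_derive. easy.
Qed.

Lemma ex_RInt_gauss (a b : R) : ex_RInt gauss a b.
Proof.
  apply (@ex_RInt_continuous R_CompleteNormedModule). intros z _. apply continuous_gauss.
Qed.

Lemma is_derive_gauss_int (x : R) : is_derive gauss_int x (gauss x).
Proof.
  apply (is_derive_RInt gauss gauss_int 0).
  - apply filter_forall. intros y. apply (@RInt_correct R_CompleteNormedModule), ex_RInt_gauss.
  - apply continuous_gauss.
Qed.

(** The classical auxiliary integrand for the Gaussian integral: its integral over t in [0, 1] has
    x-derivative [- gauss x * gauss_int x], minus half the derivative of [gauss_int x ^ 2], and at x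
    = 0 it is the derivative of the arctangent. *)
Definition polar (x t : R) : R := exp (- (x ^ 2 * (1 + t ^ 2)) / 2) / (1 + t ^ 2).

Lemma continuous_polar (x t : R) : continuous (polar x) t.
Proof.
  apply (@ex_derive_continuous R_AbsRing R_NormedModule).
  unfold polar. auto_derive. nra.
Qed.

Lemma gauss_scaled_int (x : R) :
  RInt (fun t => - x * exp (- (x ^ 2 * (1 + t ^ 2)) / 2)) 0 1 = - gauss x * gauss_int x.
Proof.
  apply is_RInt_unique.
  apply (is_RInt_ext (fun t => - gauss x * (x * gauss (x * t + 0)))).
  { intros t _. unfold gauss.
    replace (- (x ^ 2 * (1 + t ^ 2)) / 2)
      with (- x ^ 2 / 2 + - (x * t + 0) ^ 2 / 2) by field.
    rewrite exp_plus. real_eq. ring. }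
  apply (is_RInt_scal (V := R_NormedModule)).
  apply (is_RInt_comp_lin (V := R_NormedModule) gauss x 0 0 1).
  replace (x * 0 + 0) with 0 by ring. replace (x * 1 + 0) with x by ring.
  apply (RInt_correct (V := R_CompleteNormedModule)), ex_RInt_gauss.
Qed.

Lemma is_derive_polar_int (x : R) :
  is_derive (fun y => RInt (polar y) 0 1) x (- gauss x * gauss_int x).
Proof.
  rewrite <- gauss_scaled_int.
  assert (D : forall y t : R, is_derive (fun u => polar u t) y
                (- y * exp (- (y ^ 2 * (1 + t ^ 2)) / 2))).
  { intros y t. unfold polar. auto_derive; [nra|].
    replace (y * (y * 1) * (1 + t * (t * 1))) with (y ^ 2 * (1 + t ^ 2)) by ring.
    unfold Rdiv. field. nra. }
  rewrite (RInt_ext _ (fun t => Derive (fun u => polar u t) x)).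
  2:{ intros t _. symmetry. apply is_derive_unique, D. }
  apply is_derive_RInt_param.
  - apply filter_forall. intros y t _. eexists. apply D.
  - intros t _.
    apply (continuity_2d_pt_ext (fun u v => - u * exp (- (u ^ 2 * (1 + v ^ 2)) / 2))).
    { intros u v. symmetry. apply is_derive_unique, D. }
    apply continuity_2d_pt_mult.
    + apply continuity_2d_pt_opp, continuity_2d_pt_id1.
    + apply (continuity_1d_2d_pt_comp exp (fun u v => - (u ^ 2 * (1 + v ^ 2)) / 2)).
      * apply derivable_continuous_pt, derivable_pt_exp.
      * apply (continuity_2d_pt_ext (fun u v => (u * u * (1 + v * v)) * (- / 2))).
        { intros u v. field. }
        repeat (apply continuity_2d_pt_mult || apply continuity_2d_pt_plus
          || apply continuity_2d_pt_id1 || apply continuity_2d_pt_id2 || apply continuity_2d_pt_const).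
  - apply filter_forall. intros y.
    apply (@ex_RInt_continuous R_CompleteNormedModule). intros z _. apply continuous_polar.
Qed.

(* The left-hand side has zero derivative, and at [0] it is [2 * atan 1]. *)
Lemma gauss_int_sqr (x : R) : gauss_int x ^ 2 + 2 * RInt (polar x) 0 1 = PI / 2.
Proof.
  set (h := fun y => gauss_int y ^ 2 + 2 * RInt (polar y) 0 1).
  assert (D : forall y, is_derive h y 0).
  { intros y.
    assert (E0 : INR 2 * gauss y * gauss_int y ^ 1 + 2 * (- gauss y * gauss_int y) = 0)
      by (simpl; ring).
    rewrite <- E0. unfold h.
    apply (is_derive_plus (V := R_NormedModule)).
    - apply is_derive_pow, is_derive_gauss_int.
    - apply is_derive_scal, is_derive_polar_int. }
  assert (E : h x = h 0).
  { destruct (MVT_gen h 0 x (fun _ => 0)) as (c & _ & Hc).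
    - intros; apply D.
    - intros y _. apply derivable_continuous_pt. exists 0. apply is_derive_Reals, D.
    - lra. }
  fold (h x). rewrite E. unfold h.
  assert (gauss_int 0 = 0) as -> by (unfold gauss_int; apply (RInt_point (V := R_CompleteNormedModule))).
  rewrite (RInt_ext _ (fun t => / (1 + t ^ 2))).
  2:{ intros t _. unfold polar. replace (- (0 ^ 2 * (1 + t ^ 2)) / 2) with 0 by field.
      rewrite exp_0. real_eq. field. nra. }
  assert (I : is_RInt (fun t => / (1 + t ^ 2)) 0 1 (minus (atan 1) (atan 0))).
  { apply (is_RInt_derive atan).
    - intros t _. apply is_derive_Reals.
      apply derivable_pt_lim_atan.
    - intros t _. apply (@ex_derive_continuous R_AbsRing R_NormedModule). auto_derive. nra. }
  rewrite (is_RInt_unique _ _ _ _ I). rewrite atan_1, atan_0.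
  unfold minus, plus, opp; simpl. field.
Qed.

Lemma gauss_pos (x : R) : 0 < gauss x.
Proof. apply exp_pos. Qed.

Lemma gauss_int_opp (x : R) : gauss_int (- x) = - gauss_int x.
Proof.
  apply is_RInt_unique.
  apply (is_RInt_ext (fun t => - (- gauss (- t)))).
  { intros t _. unfold gauss. rewrite Ropp_involutive. f_equal. real_eq. field. }
  replace (- gauss_int x) with (opp (RInt gauss 0 x)) by reflexivity.
  apply (is_RInt_opp (V := R_NormedModule)).
  apply (is_RInt_comp_opp (V := R_NormedModule)).
  rewrite Ropp_0, Ropp_involutive.
  apply (RInt_correct (V := R_CompleteNormedModule)), ex_RInt_gauss.
Qed.

Lemma gauss_int_nonneg (x : R) : 0 <= x -> 0 <= gauss_int x.
Proof.
  intros Hx. apply RInt_ge_0; [easy|apply ex_RInt_gauss|].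
  intros t _. left. apply gauss_pos.
Qed.

Lemma sqrt_half_PI_ge_1 : 1 <= sqrt (PI / 2).
Proof.
  rewrite <- sqrt_1 at 1. apply sqrt_le_1_alt. pose proof PI2_3_2. unfold PI2 in *. lra.
Qed.

Lemma exp_le_mono (a b : R) : a <= b -> exp a <= exp b.
Proof. intros [H | ->]; [left; now apply exp_increasing|right; easy]. Qed.

Lemma polar_int_bounds (x : R) : 0 <= RInt (polar x) 0 1 <= gauss x.
Proof.
  assert (E : ex_RInt (polar x) 0 1).
  { apply (@ex_RInt_continuous R_CompleteNormedModule). intros z _. apply continuous_polar. }
  split.
  - apply RInt_ge_0; [lra|easy|]. intros t _. unfold polar.
    apply Rmult_le_pos; [left; apply exp_pos|]. left. apply Rinv_0_lt_compat. nra.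
  - replace (gauss x) with (RInt (fun _ => gauss x) 0 1).
    2:{ rewrite (RInt_const (V := R_CompleteNormedModule)). unfold scal; simpl; unfold mult; simpl. ring. }
    apply RInt_le; [lra|easy|apply ex_RInt_const|].
    intros t _. unfold polar, gauss.
    apply Rle_trans with (exp (- (x ^ 2 * (1 + t ^ 2)) / 2)).
    + rewrite <- (Rmult_1_r (exp _)) at 2. apply Rmult_le_compat_l; [left; apply exp_pos|].
      rewrite <- Rinv_1 at 2. apply Rinv_le_contravar; nra.
    + apply exp_le_mono. nra.
Qed.

(** By [gauss_int_sqr], with s the limit value, (s - g)(s + g) is twice the polar integral, hence at
    most [2 * gauss x]; and s + g is at least 1. *)
Lemma gauss_int_tail (x : R) : 0 <= x -> 0 <= sqrt (PI / 2) - gauss_int x <= 2 * gauss x.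
Proof.
  intros Hx. pose proof (gauss_int_sqr x). pose proof (polar_int_bounds x).
  pose proof (gauss_int_nonneg x Hx). pose proof sqrt_half_PI_ge_1.
  assert (Hs : sqrt (PI / 2) ^ 2 = PI / 2) by (apply pow2_sqrt; pose proof PI_RGT_0; lra).
  set (s := sqrt (PI / 2)) in *. split; nra.
Qed.

(** Integrating from 0 keeps everything within proper integrals; the improper one occurs only in
    [std_normal_cdf_Phi]. *)
Definition Phi (z : R) : R := / 2 + / sqrt (2 * PI) * gauss_int z.

Lemma sqrt_2PI_ge_1 : 1 <= sqrt (2 * PI).
Proof.
  rewrite <- sqrt_1 at 1. apply sqrt_le_1_alt. pose proof PI2_3_2. unfold PI2 in *. lra.
Qed.

Lemma inv_sqrt_2PI_bounds : 0 < / sqrt (2 * PI) <= 1.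
Proof.
  pose proof sqrt_2PI_ge_1. split.
  - apply Rinv_0_lt_compat. lra.
  - rewrite <- Rinv_1. apply Rinv_le_contravar; lra.
Qed.

Lemma inv_sqrt_2PI_mul : / sqrt (2 * PI) * sqrt (PI / 2) = / 2.
Proof.
  replace (2 * PI) with (2 ^ 2 * (PI / 2)) by field.
  pose proof PI_RGT_0.
  rewrite sqrt_mult by lra. rewrite sqrt_pow2 by lra.
  pose proof sqrt_half_PI_ge_1. field. lra.
Qed.

Lemma std_normal_cdf_Phi (x0 : R) : std_normal_cdf x0 = Phi x0.
Proof.
  unfold std_normal_cdf, Phi. rewrite <- inv_sqrt_2PI_mul, <- Rmult_plus_distr_l. f_equal.
  apply (is_RInt_gen_unique (V := R_CompleteNormedModule)).
  intros P [eps HP].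
  (* Below this threshold [- a] exceeds 2 / eps, which brings the tail bound [2 * gauss (- a)] under
     eps. The [Rmax] with 0 supplies the sign of [a]. *)
  apply (Filter_prod _ _ _ (fun a => a < - Rmax 0 (2 / eps + 1)) (fun b => b = x0)).
  - exists (- Rmax 0 (2 / eps + 1)). easy.
  - reflexivity.
  - intros a b Ha ->. exists (gauss_int x0 - gauss_int a). split.
    + replace (gauss_int x0 - gauss_int a) with (plus (opp (gauss_int a)) (gauss_int x0))
        by (unfold plus, opp; simpl; ring).
      apply (is_RInt_Chasles (V := R_NormedModule) _ a 0).
      * apply (is_RInt_swap (V := R_NormedModule)), (RInt_correct (V := R_CompleteNormedModule)), ex_RInt_gauss.
      * apply (RInt_correct (V := R_CompleteNormedModule)), ex_RInt_gauss.
    + apply HP. change (Rabs (gauss_int x0 - gauss_int a - (sqrt (PI / 2) + gauss_int x0)) < eps).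
      pose proof (Rmax_l 0 (2 / eps + 1)). pose proof (Rmax_r 0 (2 / eps + 1)).
      replace a with (- (- a)) by ring. rewrite gauss_int_opp.
      destruct (gauss_int_tail (- a)) as [T1 T2]; [simpl in *; lra|].
      replace (gauss_int x0 - - gauss_int (- a) - (sqrt (PI / 2) + gauss_int x0))
        with (- (sqrt (PI / 2) - gauss_int (- a))) by ring.
      rewrite Rabs_Ropp, Rabs_pos_eq by easy.
      apply Rle_lt_trans with (1 := T2).
      (* [gauss t <= 1 / (1 + t ^ 2 / 2) <= 1 / t] at [t = - a] *)
      unfold gauss. pose proof (exp_ineq1_le ((- a) ^ 2 / 2)) as E.
      replace (- (- a) ^ 2 / 2) with (- ((- a) ^ 2 / 2)) by field. rewrite exp_Ropp.
      assert (He := cond_pos eps).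
      assert (2 < eps * exp ((- a) ^ 2 / 2)).
      { assert (eps * (2 / eps + 1) < eps * - a) by (apply Rmult_lt_compat_l; simpl in *; lra).
        assert (eps * (2 / eps + 1) = 2 + eps) as E2 by (field; lra).
        assert (- a <= exp ((- a) ^ 2 / 2)) by nra. nra. }
      apply (Rmult_lt_reg_r (exp ((- a) ^ 2 / 2))); [apply exp_pos|].
      rewrite Rmult_assoc, Rinv_l; [lra|]. apply Rgt_not_eq, exp_pos.
Qed.

Lemma Phi_opp (z : R) : Phi (- z) = 1 - Phi z.
Proof. unfold Phi. rewrite gauss_int_opp. field. pose proof sqrt_2PI_ge_1. lra. Qed.

Lemma Phi_tail (z : R) : 0 <= z -> 0 <= 1 - Phi z <= 2 * gauss z.
Proof.
  intros Hz. destruct (gauss_int_tail z Hz) as [T1 T2].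
  assert (1 - Phi z = / sqrt (2 * PI) * (sqrt (PI / 2) - gauss_int z)) as ->.
  { rewrite Rmult_minus_distr_l, inv_sqrt_2PI_mul. unfold Phi. lra. }
  destruct inv_sqrt_2PI_bounds as [B1 B2]. split; [apply Rmult_le_pos; lra|].
  pose proof (gauss_pos z). nra.
Qed.

(** * Derivatives of the normal distribution function and their bounds *)

Definition Phi1 (z : R) : R := / sqrt (2 * PI) * gauss z.
Definition Phi2 (z : R) : R := / sqrt (2 * PI) * (- z * gauss z).
Definition Phi3 (z : R) : R := / sqrt (2 * PI) * ((z ^ 2 - 1) * gauss z).
Definition Phi4 (z : R) : R := / sqrt (2 * PI) * ((3 * z - z ^ 3) * gauss z).

Lemma is_derive_Phi (z : R) : is_derive Phi z (Phi1 z).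
Proof.
  assert (H : is_derive Phi z (plus 0 (Phi1 z))).
  { apply (is_derive_plus (V := R_NormedModule)).
    - apply (is_derive_const (V := R_NormedModule)).
    - apply is_derive_scal, is_derive_gauss_int. }
  replace (plus 0 (Phi1 z)) with (Phi1 z) in H; [easy|unfold plus; simpl; ring].
Qed.

Lemma is_derive_Phi1 (z : R) : is_derive Phi1 z (Phi2 z).
Proof.
  apply is_derive_scal. unfold gauss. auto_derive; [easy|]. unfold Rdiv.
  replace (z * (z * 1)) with (z ^ 2) by ring. field.
Qed.

Lemma is_derive_Phi2 (z : R) : is_derive Phi2 z (Phi3 z).
Proof.
  apply is_derive_scal. unfold gauss. auto_derive; [easy|]. unfold Rdiv.
  replace (z * (z * 1)) with (z ^ 2) by ring. field.
Qed.

Lemma is_derive_Phi3 (z : R) : is_derive Phi3 z (Phi4 z).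
Proof.
  apply is_derive_scal. unfold gauss. auto_derive; [easy|]. unfold Rdiv.
  replace (z * (z * 1)) with (z ^ 2) by ring. field.
Qed.

Lemma exp_ge_quadratic (x : R) : 0 <= x -> (1 + x / 2) ^ 2 <= exp x.
Proof.
  intros Hx. pose proof (exp_ineq1_le (x / 2)).
  replace x with (x / 2 + x / 2) at 2 by field. rewrite exp_plus. nra.
Qed.

(** Half of the Gaussian exponent absorbs the cubic factor through [exp_ge_quadratic]; the other
    half is kept as the decay that the envelope exploits. *)
Lemma Phi4_bound (z : R) : Rabs (Phi4 z) <= 32 * exp (- z ^ 2 / 4).
Proof.
  destruct inv_sqrt_2PI_bounds as [B1 B2]. unfold Phi4, gauss.
  rewrite !Rabs_mult, (Rabs_pos_eq (/ _)), (Rabs_pos_eq (exp _)) by (left; first [easy|apply exp_pos]).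
  replace (- z ^ 2 / 2) with (- z ^ 2 / 4 + - (z ^ 2 / 4)) by field.
  rewrite exp_plus, exp_Ropp.
  pose proof (exp_ge_quadratic (z ^ 2 / 4)) as E. specialize (E ltac:(nra)).
  set (e := exp (z ^ 2 / 4)) in *. pose proof (exp_pos (- z ^ 2 / 4)) as Hg.
  set (g := exp (- z ^ 2 / 4)) in *.
  assert (He : 0 < e) by apply exp_pos.
  assert (P : Rabs (3 * z - z ^ 3) <= 32 * e) by (apply Rabs_le; nra).
  assert (Q : Rabs (3 * z - z ^ 3) * / e <= 32).
  { apply (Rmult_le_reg_r e); [easy|]. rewrite Rmult_assoc, Rinv_l; lra. }
  pose proof (Rabs_pos (3 * z - z ^ 3)) as Hp.
  assert (0 <= Rabs (3 * z - z ^ 3) * / e) by (apply Rmult_le_pos; [easy|left; now apply Rinv_0_lt_compat]).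
  replace (Rabs (3 * z - z ^ 3) * (g * / e)) with ((Rabs (3 * z - z ^ 3) * / e) * g) by ring.
  assert ((Rabs (3 * z - z ^ 3) * / e) * g <= 32 * g) by nra.
  assert (0 <= (Rabs (3 * z - z ^ 3) * / e) * g) by nra. nra.
Qed.

Lemma Phi4_bound_const (z : R) : Rabs (Phi4 z) <= 32.
Proof.
  pose proof (Phi4_bound z).
  assert (exp (- z ^ 2 / 4) <= 1) by (rewrite <- exp_0; apply exp_le_mono; nra). lra.
Qed.

Lemma Phi3_bound (z : R) : Rabs (Phi3 z) <= 2.
Proof.
  destruct inv_sqrt_2PI_bounds as [B1 B2]. unfold Phi3, gauss.
  rewrite !Rabs_mult, (Rabs_pos_eq (/ _)), (Rabs_pos_eq (exp _)) by (left; first [easy|apply exp_pos]).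
  replace (- z ^ 2 / 2) with (- (z ^ 2 / 2)) by field. rewrite exp_Ropp.
  pose proof (exp_ineq1_le (z ^ 2 / 2)). set (e := exp (z ^ 2 / 2)) in *.
  assert (He : 0 < e) by apply exp_pos.
  assert (P : Rabs (z ^ 2 - 1) <= 2 * e) by (apply Rabs_le; nra).
  assert (Q : Rabs (z ^ 2 - 1) * / e <= 2).
  { apply (Rmult_le_reg_r e); [easy|]. rewrite Rmult_assoc, Rinv_l; lra. }
  assert (0 <= Rabs (z ^ 2 - 1) * / e)
    by (apply Rmult_le_pos; [apply Rabs_pos|left; now apply Rinv_0_lt_compat]).
  nra.
Qed.

Lemma Phi2_bound (z : R) : Rabs (Phi2 z) <= 1.
Proof.
  destruct inv_sqrt_2PI_bounds as [B1 B2]. unfold Phi2, gauss.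
  rewrite !Rabs_mult, (Rabs_pos_eq (/ _)), (Rabs_pos_eq (exp _)) by (left; first [easy|apply exp_pos]).
  replace (- z ^ 2 / 2) with (- (z ^ 2 / 2)) by field. rewrite exp_Ropp.
  pose proof (exp_ineq1_le (z ^ 2 / 2)). set (e := exp (z ^ 2 / 2)) in *.
  assert (He : 0 < e) by apply exp_pos.
  assert (P : Rabs (- z) <= 1 * e) by (apply Rabs_le; nra).
  assert (Q : Rabs (- z) * / e <= 1).
  { apply (Rmult_le_reg_r e); [easy|]. rewrite Rmult_assoc, Rinv_l; lra. }
  assert (0 <= Rabs (- z) * / e)
    by (apply Rmult_le_pos; [apply Rabs_pos|left; now apply Rinv_0_lt_compat]).
  nra.
Qed.

Lemma Phi1_bounds (z : R) : 0 < Phi1 z <= 1.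
Proof.
  destruct inv_sqrt_2PI_bounds as [B1 B2]. unfold Phi1. pose proof (gauss_pos z).
  assert (gauss z <= 1) by (unfold gauss; rewrite <- exp_0; apply exp_le_mono; nra).
  split; nra.
Qed.

Lemma Phi_MVT (a b : R) : exists c, Rmin a b <= c <= Rmax a b /\ Phi b - Phi a = Phi1 c * (b - a).
Proof.
  apply MVT_gen.
  - intros; apply is_derive_Phi.
  - intros x _. apply derivable_continuous_pt. exists (Phi1 x). apply is_derive_Reals, is_derive_Phi.
Qed.

Lemma Phi_increasing (a b : R) : a <= b -> Phi a <= Phi b.
Proof.
  intros H. destruct (Phi_MVT a b) as (c & _ & E). pose proof (Phi1_bounds c). nra.
Qed.

Lemma Phi_lipschitz (a b : R) : a <= b -> Phi b - Phi a <= b - a.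
Proof.
  intros H. destruct (Phi_MVT a b) as (c & _ & E). pose proof (Phi1_bounds c). nra.
Qed.

(* The envelope dominates the fourth derivative of [Phi] near [z], and is in turn dominated by a
   difference of values of [Phi], hence its expectation is controlled by the smoothed distribution
   function itself. *)
Definition env (z : R) : R := exp (- z ^ 2 / 8).

Lemma env_pos (z : R) : 0 < env z.
Proof. apply exp_pos. Qed.

Lemma env_opp (z : R) : env (- z) = env z.
Proof. unfold env. f_equal. field. Qed.

Lemma exp_quarter_le : exp (/ 4) <= 3.
Proof. apply Rle_trans with (exp 1); [apply exp_le_mono; lra|apply exp_le_3]. Qed.

(** The hypothesis is tailored to two displacements: a shift of z by at most 1, and a division of z
    by at most sqrt 2 when the variance at most doubles. *)
Lemma Phi4_env (z w : R) : z ^ 2 / 2 - 1 <= w ^ 2 -> Rabs (Phi4 w) <= 96 * env z.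
Proof.
  intros H. apply Rle_trans with (1 := Phi4_bound w).
  assert (exp (- w ^ 2 / 4) <= exp (/ 4) * env z).
  { unfold env. rewrite <- exp_plus. apply exp_le_mono. lra. }
  pose proof exp_quarter_le. pose proof (env_pos z). nra.
Qed.

Lemma Phi_tail_env (z : R) : 0 <= z -> 0 <= 1 - Phi z <= 2 * env z.
Proof.
  intros Hz. destruct (Phi_tail z Hz). split; [easy|].
  apply Rle_trans with (1 := H0). apply Rmult_le_compat_l; [lra|]. apply exp_le_mono. nra.
Qed.

Definition env_const : R := 3 * sqrt (2 * PI).

Lemma env_const_pos : 0 < env_const.
Proof. unfold env_const. pose proof sqrt_2PI_ge_1. lra. Qed.

(** The mean value theorem is applied on the half of the interval that lies from z / 2 towards the
    origin; it has length 1, and every c in it satisfies c^2 <= (z / 2)^2 + 1, so [gauss c] is at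
    least [env z] divided by e. The 3 in [env_const] bounds e. *)
Lemma env_le_Phi_diff (z : R) : env z <= env_const * (Phi ((z + 2) / 2) - Phi ((z - 2) / 2)).
Proof.
  assert (K : forall c, c ^ 2 <= (z / 2) ^ 2 + 1 -> env z <= env_const * Phi1 c).
  { intros c Hc. unfold env_const, Phi1. pose proof sqrt_2PI_ge_1.
    replace (3 * sqrt (2 * PI) * (/ sqrt (2 * PI) * gauss c)) with (3 * gauss c) by (field; lra).
    assert (env z <= exp 1 * gauss c).
    { unfold env, gauss. rewrite <- exp_plus. apply exp_le_mono. lra. }
    pose proof exp_le_3. pose proof (gauss_pos c). nra. }
  pose proof env_const_pos.
  destruct (Rle_dec 0 z).
  - destruct (Phi_MVT ((z - 2) / 2) (z / 2)) as (c & Hc & E).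
    rewrite Rmin_left, Rmax_right in Hc by lra.
    pose proof (Phi_increasing (z / 2) ((z + 2) / 2) ltac:(lra)).
    specialize (K c ltac:(nra)). nra.
  - destruct (Phi_MVT (z / 2) ((z + 2) / 2)) as (c & Hc & E).
    rewrite Rmin_left, Rmax_right in Hc by lra.
    pose proof (Phi_increasing ((z - 2) / 2) (z / 2) ltac:(lra)).
    specialize (K c ltac:(nra)). nra.
Qed.

(** * Taylor expansions in the space variable and in the variance *)

(** One integration step of Taylor's formula. Iterating it from the highest derivative downwards
    yields an explicit remainder. *)
Lemma derive_power_growth (g dg : R -> R) (B : R) (k : nat) :
  (forall t, 0 <= t <= 1 -> is_derive g t (dg t)) -> g 0 = 0 ->
  (forall t, 0 <= t <= 1 -> Rabs (dg t) <= B * t ^ k) ->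
  forall t, 0 <= t <= 1 -> Rabs (g t) <= B / INR (S k) * t ^ S k.
Proof.
  intros D G0 Hd t Ht.
  assert (Hk : INR (S k) <> 0) by (apply not_0_INR; lia).
  (* The signs s = 1 and s = -1 turn the absolute value into two monotonicity statements. *)
  assert (M : forall s, Rabs s <= 1 -> s * g t <= B / INR (S k) * t ^ S k).
  { intros s Hs.
    assert (DH : forall x, 0 <= x <= t ->
      is_derive (fun u => B / INR (S k) * u ^ S k - s * g u) x (B * x ^ k - s * dg x)).
    { intros x Hx. apply (is_derive_minus (V := R_NormedModule)).
      - replace (B * x ^ k) with (B / INR (S k) * (INR (S k) * 1 * x ^ k)) by (now field).
        apply is_derive_scal. apply (is_derive_pow (fun u => u) (S k) x 1).
        apply (is_derive_id (K := R_AbsRing)).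
      - apply is_derive_scal, D. lra. }
    destruct (MVT_gen (fun u => B / INR (S k) * u ^ S k - s * g u) 0 t
                (fun u => B * u ^ k - s * dg u)) as (c & Hc & E).
    - rewrite Rmin_left, Rmax_right by lra. intros x Hx. apply DH. lra.
    - rewrite Rmin_left, Rmax_right by lra. intros x Hx.
      apply derivable_continuous_pt. eexists. now apply is_derive_Reals, DH.
    - rewrite Rmin_left, Rmax_right in Hc by lra.
      rewrite G0 in E. rewrite pow_i in E by lia.
      assert (s * dg c <= B * c ^ k).
      { apply Rle_trans with (2 := Hd c ltac:(lra)).
        apply Rle_trans with (1 := Rle_abs _). rewrite Rabs_mult.
        pose proof (Rabs_pos (dg c)). nra. }
      nra. }
  apply Rabs_le. split.
  - specialize (M (-1)). rewrite Rabs_left in M by lra. specialize (M ltac:(lra)). lra.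
  - specialize (M 1). rewrite Rabs_right in M by lra. specialize (M ltac:(lra)). lra.
Qed.

Lemma Phi_taylor (z h W : R) :
  (forall t, 0 <= t <= 1 -> Rabs (Phi4 (z + t * h)) <= W) ->
  Rabs (Phi (z + h) - (Phi z + h * Phi1 z + h ^ 2 / 2 * Phi2 z + h ^ 3 / 6 * Phi3 z))
    <= W * h ^ 4 / 24.
Proof.
  intros HW.
  assert (L : forall (f df : R -> R), (forall x, is_derive f x (df x)) ->
      forall t, is_derive (fun u => f (z + u * h)) t (h * df (z + t * h))).
  { intros f df D t. apply (is_derive_comp (K := R_AbsRing) (V := R_NormedModule) f (fun u => z + u * h)).
    - apply D.
    - auto_derive; [easy|ring]. }
  assert (H4 : 0 <= h ^ 4) by (replace (h ^ 4) with ((h ^ 2) ^ 2) by ring; nra).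
  (* Each of the four remainders, taken with its power of h, is the derivative in t of the next one;
     the divisors 1, 2, 3, 4 accumulate to 24. *)
  assert (G3 := derive_power_growth (fun t => h ^ 3 * (Phi3 (z + t * h) - Phi3 z))
                  (fun t => h ^ 3 * (h * Phi4 (z + t * h) - 0)) (W * h ^ 4) 0).
  assert (G2 := derive_power_growth (fun t => h ^ 2 * (Phi2 (z + t * h) - (Phi2 z + t * h * Phi3 z)))
                  (fun t => h ^ 2 * (h * Phi3 (z + t * h) - h * Phi3 z)) (W * h ^ 4 / INR 1) 1).
  assert (G1 := derive_power_growth
                  (fun t => h * (Phi1 (z + t * h) - (Phi1 z + t * h * Phi2 z + (t * h) ^ 2 / 2 * Phi3 z)))
                  (fun t => h * (h * Phi2 (z + t * h) - (h * Phi2 z + t * h * h * Phi3 z)))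
                  (W * h ^ 4 / INR 1 / INR 2) 2).
  assert (G0 := derive_power_growth
                  (fun t => Phi (z + t * h) - (Phi z + t * h * Phi1 z + (t * h) ^ 2 / 2 * Phi2 z
                                               + (t * h) ^ 3 / 6 * Phi3 z))
                  (fun t => h * Phi1 (z + t * h) - (h * Phi1 z + t * h * h * Phi2 z
                                               + (t * h) ^ 2 / 2 * h * Phi3 z))
                  (W * h ^ 4 / INR 1 / INR 2 / INR 3) 3).
  specialize (G3 ltac:(intros t _; apply is_derive_scal, (is_derive_minus (V := R_NormedModule));
                       [apply (L _ _ is_derive_Phi3)|auto_derive; easy])
                 ltac:(cbv beta; rewrite Rmult_0_l, Rplus_0_r; ring)).
  specialize (G3 ltac:(intros t Ht; cbv beta; rewrite Rminus_0_r, <- Rmult_assoc, Rabs_mult;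
     replace (h ^ 3 * h) with (h ^ 4) by ring; rewrite (Rabs_pos_eq (h ^ 4)) by easy;
     specialize (HW t Ht); simpl pow at 2; nra)).
  specialize (G2 ltac:(intros t _; apply is_derive_scal, (is_derive_minus (V := R_NormedModule));
                       [apply (L _ _ is_derive_Phi2)|auto_derive; [easy|ring]])
                 ltac:(cbv beta; rewrite Rmult_0_l, Rplus_0_r; ring)).
  specialize (G2 ltac:(intros t Ht; cbv beta; rewrite <- Rmult_minus_distr_l, <- Rmult_assoc;
     replace (h ^ 2 * h) with (h ^ 3) by ring; apply G3, Ht)).
  specialize (G1 ltac:(intros t _; apply is_derive_scal, (is_derive_minus (V := R_NormedModule));
                       [apply (L _ _ is_derive_Phi1)|auto_derive; [easy|field]])
                 ltac:(cbv beta; rewrite Rmult_0_l, Rplus_0_r; field)).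
  specialize (G1 ltac:(intros t Ht; cbv beta;
     replace (h * (h * Phi2 (z + t * h) - (h * Phi2 z + t * h * h * Phi3 z)))
       with (h ^ 2 * (Phi2 (z + t * h) - (Phi2 z + t * h * Phi3 z))) by ring; apply G2, Ht)).
  specialize (G0 ltac:(intros t _; apply (is_derive_minus (V := R_NormedModule));
                       [apply (L _ _ is_derive_Phi)|auto_derive; [easy|field]])
                 ltac:(cbv beta; rewrite Rmult_0_l, Rplus_0_r; field)).
  specialize (G0 ltac:(intros t Ht; cbv beta;
     replace (h * Phi1 (z + t * h) - (h * Phi1 z + t * h * h * Phi2 z + (t * h) ^ 2 / 2 * h * Phi3 z))
       with (h * (Phi1 (z + t * h) - (Phi1 z + t * h * Phi2 z + (t * h) ^ 2 / 2 * Phi3 z))) by field;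
     apply G1, Ht)).
  specialize (G0 1 ltac:(lra)). cbn beta in G0. rewrite !Rmult_1_l in G0.
  replace (W * h ^ 4 / 24) with (W * h ^ 4 / INR 1 / INR 2 / INR 3 / INR 4 * 1 ^ 4) by (simpl; field).
  exact G0.
Qed.

Lemma is_derive_div_sqrt (w v : R) : 0 < v ->
  is_derive (fun u => w / sqrt u) v (- (w / sqrt v) / (2 * v)).
Proof.
  intros Hv. pose proof (sqrt_lt_R0 v Hv). auto_derive.
  - repeat split; lra.
  - replace (2 * v) with (2 * (sqrt v * sqrt v)) by (rewrite sqrt_sqrt; lra). field. lra.
Qed.

(** The heat equation: the derivative in the variance is half the second derivative in w. *)
Lemma is_derive_Phi_var (w v : R) : 0 < v ->
  is_derive (fun u => Phi (w / sqrt u)) v (Phi2 (w / sqrt v) / (2 * v)).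
Proof.
  intros Hv.
  replace (Phi2 (w / sqrt v) / (2 * v))
    with (scal (- (w / sqrt v) / (2 * v)) (Phi1 (w / sqrt v))).
  - apply (is_derive_comp (K := R_AbsRing) (V := R_NormedModule) Phi).
    + apply is_derive_Phi.
    + now apply is_derive_div_sqrt.
  - unfold scal; simpl; unfold mult; simpl. unfold Phi1, Phi2.
    pose proof (sqrt_lt_R0 v Hv). pose proof sqrt_2PI_ge_1. field. lra.
Qed.

Lemma is_derive_Phi_var2 (w v : R) : 0 < v ->
  is_derive (fun u => Phi2 (w / sqrt u) / (2 * u)) v (Phi4 (w / sqrt v) / (4 * v ^ 2)).
Proof.
  intros Hv.
  assert (D : is_derive (fun u => Phi2 (w / sqrt u)) v
                (scal (- (w / sqrt v) / (2 * v)) (Phi3 (w / sqrt v)))).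
  { apply (is_derive_comp (K := R_AbsRing) (V := R_NormedModule) Phi2).
    - apply is_derive_Phi2.
    - now apply is_derive_div_sqrt. }
  assert (E : Phi4 (w / sqrt v) / (4 * v ^ 2) =
     (- (w / sqrt v) / (2 * v) * Phi3 (w / sqrt v)) * / (2 * v)
       + Phi2 (w / sqrt v) * (- 2 / (2 * v) ^ 2)).
  { unfold Phi2, Phi3, Phi4. set (z := w / sqrt v).
    pose proof sqrt_2PI_ge_1. field. lra. }
  rewrite E.
  apply (is_derive_mult (K := R_AbsRing) (fun u => Phi2 (w / sqrt u)) (fun u => / (2 * u)) v
           (- (w / sqrt v) / (2 * v) * Phi3 (w / sqrt v)) (- 2 / (2 * v) ^ 2)).
  - exact D.
  - auto_derive; [lra|field; lra].
  - intros; apply Rmult_comm.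
Qed.

Lemma Phi_var_taylor (w v d W : R) : 0 < v -> 0 <= d ->
  (forall u, v <= u <= v + d -> Rabs (Phi4 (w / sqrt u)) <= W) ->
  Rabs (Phi (w / sqrt (v + d)) - (Phi (w / sqrt v) + d * (Phi2 (w / sqrt v) / (2 * v))))
    <= W * d ^ 2 / (8 * v ^ 2).
Proof.
  intros Hv Hd HW.
  assert (L : forall (f df : R -> R), (forall x, 0 < x -> is_derive f x (df x)) ->
      forall t, 0 <= t <= 1 -> is_derive (fun u => f (v + u * d)) t (d * df (v + t * d))).
  { intros f df D t Ht.
    apply (is_derive_comp (K := R_AbsRing) (V := R_NormedModule) f (fun u => v + u * d)).
    - apply D. nra.
    - auto_derive; [easy|ring]. }
  set (f1 := fun u => Phi2 (w / sqrt u) / (2 * u)).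
  assert (G1 := derive_power_growth (fun t => d * (f1 (v + t * d) - f1 v))
     (fun t => d * (d * (Phi4 (w / sqrt (v + t * d)) / (4 * (v + t * d) ^ 2)) - 0))
     (W * d ^ 2 / (4 * v ^ 2)) 0).
  assert (G0 := derive_power_growth (fun t => Phi (w / sqrt (v + t * d)) - (Phi (w / sqrt v) + t * d * f1 v))
     (fun t => d * f1 (v + t * d) - d * f1 v) (W * d ^ 2 / (4 * v ^ 2) / INR 1) 1).
  specialize (G1 ltac:(intros t Ht; cbv beta; apply is_derive_scal, (is_derive_minus (V := R_NormedModule));
     [apply (L f1 _ (is_derive_Phi_var2 w) t Ht)|auto_derive; easy])
     ltac:(cbv beta; rewrite Rmult_0_l, Rplus_0_r; ring)).
  specialize (G0 ltac:(intros t Ht; cbv beta; apply (is_derive_minus (V := R_NormedModule));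
     [apply (L _ _ (is_derive_Phi_var w) t Ht)|auto_derive; [easy|ring]])
     ltac:(cbv beta; rewrite Rmult_0_l, Rplus_0_r; ring)).
  assert (B1 : forall t, 0 <= t <= 1 ->
     Rabs (d * (d * (Phi4 (w / sqrt (v + t * d)) / (4 * (v + t * d) ^ 2)) - 0))
       <= W * d ^ 2 / (4 * v ^ 2) * t ^ 0).
  { intros t Ht. rewrite Rminus_0_r, Rmult_1_r.
    replace (d * (d * (Phi4 (w / sqrt (v + t * d)) / (4 * (v + t * d) ^ 2))))
      with (Phi4 (w / sqrt (v + t * d)) * (d ^ 2 / (4 * (v + t * d) ^ 2))) by (field; nra).
    replace (W * d ^ 2 / (4 * v ^ 2)) with (W * (d ^ 2 / (4 * v ^ 2))) by (field; lra).
    rewrite Rabs_mult.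
    specialize (HW (v + t * d) ltac:(nra)).
    assert (v <= v + t * d) by nra.
    assert (0 < v ^ 2) by nra. assert (v ^ 2 <= (v + t * d) ^ 2) by (apply pow_incr; lra).
    pose proof (pow2_ge_0 d).
    rewrite (Rabs_pos_eq (_ / _)).
    2:{ apply Rmult_le_pos; [nra|]. left. apply Rinv_0_lt_compat. lra. }
    apply Rmult_le_compat; [apply Rabs_pos| |exact HW|].
    - apply Rmult_le_pos; [nra|]. left. apply Rinv_0_lt_compat. lra.
    - apply Rmult_le_compat_l; [nra|]. apply Rinv_le_contravar; lra. }
  specialize (G1 B1).
  specialize (G0 ltac:(intros t Ht; cbv beta; rewrite <- Rmult_minus_distr_l; apply G1, Ht)).
  specialize (G0 1 ltac:(lra)). cbn beta in G0. rewrite !Rmult_1_l in G0.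
  replace (W * d ^ 2 / (8 * v ^ 2)) with (W * d ^ 2 / (4 * v ^ 2) / INR 1 / INR 2 * 1 ^ 2)
    by (simpl; field; lra).
  exact G0.
Qed.

(** * Sums over lists *)

Definition lsum {A : Type} (l : list A) (f : A -> R) : R := sumR (map f l).

Section ListSums.

Context {A : Type}.
Implicit Types (l : list A) (f g : A -> R).

Lemma lsum_cons a l f : lsum (a :: l) f = f a + lsum l f.
Proof. reflexivity. Qed.

Lemma lsum_app l l' f : lsum (l ++ l') f = lsum l f + lsum l' f.
Proof. induction l; [unfold lsum; simpl; ring|]. rewrite <- app_comm_cons, !lsum_cons, IHl. ring. Qed.

Lemma lsum_ext l f g : (forall a, In a l -> f a = g a) -> lsum l f = lsum l g.
Proof. intros H. unfold lsum. f_equal. now apply map_ext_in. Qed.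

Lemma lsum_plus l f g : lsum l (fun a => f a + g a) = lsum l f + lsum l g.
Proof. induction l; [unfold lsum; simpl; ring|]. rewrite !lsum_cons, IHl. ring. Qed.

Lemma lsum_scal l (c : R) f : lsum l (fun a => c * f a) = c * lsum l f.
Proof. induction l; [unfold lsum; simpl; ring|]. rewrite !lsum_cons, IHl. ring. Qed.

Lemma lsum_minus l f g : lsum l (fun a => f a - g a) = lsum l f - lsum l g.
Proof. induction l; [unfold lsum; simpl; ring|]. rewrite !lsum_cons, IHl. ring. Qed.

Lemma lsum_le l f g : (forall a, In a l -> f a <= g a) -> lsum l f <= lsum l g.
Proof.
  induction l; intros H; [unfold lsum; simpl; lra|]. rewrite !lsum_cons.
  apply Rplus_le_compat; [apply H; now left|]. apply IHl. intros; apply H; now right.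
Qed.

Lemma lsum_nonneg l f : (forall a, In a l -> 0 <= f a) -> 0 <= lsum l f.
Proof.
  intros H. replace 0 with (lsum l (fun _ => 0)); [now apply lsum_le|].
  induction l; [reflexivity|]. rewrite lsum_cons, IHl; [ring|]. intros; apply H; now right.
Qed.

Lemma lsum_0 l f : (forall a, In a l -> f a = 0) -> lsum l f = 0.
Proof.
  intros H. rewrite (lsum_ext _ _ (fun _ => 0 * 0)) by (intros; rewrite H by easy; ring).
  rewrite lsum_scal. ring.
Qed.

Lemma lsum_Rabs l f : Rabs (lsum l f) <= lsum l (fun a => Rabs (f a)).
Proof.
  induction l; [unfold lsum; simpl; rewrite Rabs_R0; lra|]. rewrite !lsum_cons.
  apply Rle_trans with (1 := Rabs_triang _ _). lra.
Qed.

Lemma lsum_permutation l l' f : Permutation l l' -> lsum l f = lsum l' f.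
Proof. induction 1; rewrite ?lsum_cons; lra. Qed.

Lemma lsum_filter (b : A -> bool) l f :
  lsum (filter b l) f = lsum l (fun a => if b a then f a else 0).
Proof.
  induction l; [reflexivity|]. simpl filter. rewrite lsum_cons, <- IHl.
  destruct (b a); rewrite ?lsum_cons; lra.
Qed.

Lemma lsum_incl_le l l' f :
  NoDup l -> incl l l' -> (forall a, In a l' -> 0 <= f a) -> lsum l f <= lsum l' f.
Proof.
  intros Hl. revert l'. induction Hl as [|a l Ha Hl IH]; intros l' Hi Hf.
  - now apply lsum_nonneg.
  - destruct (in_split a l') as (l1 & l2 & ->); [apply Hi; now left|].
    rewrite lsum_cons.
    rewrite (lsum_permutation (l1 ++ a :: l2) (a :: l1 ++ l2))
      by (symmetry; apply Permutation_middle).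
    rewrite lsum_cons. apply Rplus_le_compat_l, IH.
    + intros b Hb. specialize (Hi b (or_intror Hb)).
      rewrite in_app_iff in *. simpl in Hi. destruct Hi as [|[->|]]; tauto.
    + intros b Hb. apply Hf. rewrite in_app_iff in *. simpl. tauto.
Qed.

End ListSums.

Lemma lsum_map {A B : Type} (h : A -> B) (l : list A) (f : B -> R) :
  lsum (map h l) f = lsum l (fun a => f (h a)).
Proof. unfold lsum. now rewrite map_map. Qed.

Lemma lsum_flat_map {A B : Type} (h : A -> list B) (l : list A) (f : B -> R) :
  lsum (flat_map h l) f = lsum l (fun a => lsum (h a) f).
Proof. induction l; [reflexivity|]. simpl flat_map. now rewrite lsum_app, lsum_cons, IHl. Qed.

Lemma lsum_swap {A B : Type} (l : list A) (l' : list B) (f : A -> B -> R) :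
  lsum l (fun a => lsum l' (f a)) = lsum l' (fun b => lsum l (fun a => f a b)).
Proof.
  induction l.
  - symmetry. apply lsum_0. reflexivity.
  - rewrite lsum_cons, IHl, <- lsum_plus. apply lsum_ext. reflexivity.
Qed.

Lemma lsum_seq_S (n : nat) (f : nat -> R) :
  lsum (seq 0 (S n)) f = f 0%nat + lsum (seq 0 n) (fun k => f (S k)).
Proof. rewrite <- cons_seq, lsum_cons, <- seq_shift, lsum_map. reflexivity. Qed.

Lemma lsum_seq_S_r (n : nat) (f : nat -> R) :
  lsum (seq 0 (S n)) f = lsum (seq 0 n) f + f n.
Proof. rewrite seq_S, lsum_app, lsum_cons. unfold lsum at 2. simpl. ring. Qed.

Lemma lsum_telescope (n : nat) (f : nat -> R) :
  lsum (seq 0 n) (fun k => f (S k) - f k) = f n - f 0%nat.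
Proof. induction n; [unfold lsum; simpl; ring|]. rewrite lsum_seq_S_r, IHn. ring. Qed.

(** * One random jump compared with the heat flow *)

Lemma pow4_nonneg (x : R) : 0 <= x ^ 4.
Proof. replace (x ^ 4) with ((x ^ 2) ^ 2) by ring. apply pow2_ge_0. Qed.

Lemma pow4_le_Rabs (x b : R) : Rabs x <= b -> x ^ 4 <= b ^ 4.
Proof.
  intros H. pose proof (Rabs_pos x).
  replace (x ^ 4) with (Rabs x ^ 4); [apply pow_incr; lra|].
  rewrite RPow_abs. apply Rabs_pos_eq, pow4_nonneg.
Qed.

Lemma sqrt_pow3 (v : R) : 0 < v -> sqrt v ^ 3 = v * sqrt v.
Proof. intros. replace (sqrt v ^ 3) with ((sqrt v * sqrt v) * sqrt v) by ring. now rewrite sqrt_sqrt by lra. Qed.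

(* The variance of a mean-zero jump is matched by an increase of the smoothing variance. *)
Lemma jump_vs_heat {A : Type} (l : list A) (p X : A -> R) (w v d m b W : R) :
  (forall a, In a l -> 0 <= p a) -> lsum l p = 1 ->
  lsum l (fun a => p a * X a) = 0 -> lsum l (fun a => p a * X a ^ 2) = d ->
  lsum l (fun a => p a * X a ^ 3) = m ->
  (forall a, In a l -> Rabs (X a) <= b) -> 0 < v -> 0 <= d ->
  (forall x, Rabs x <= b -> Rabs (Phi4 (w / sqrt v + x / sqrt v)) <= W) ->
  (forall u, v <= u <= v + d -> Rabs (Phi4 (w / sqrt u)) <= W) ->
  Rabs (lsum l (fun a => p a * Phi ((w - X a) / sqrt v)) - Phi (w / sqrt (v + d)))
    <= Rabs m / sqrt v ^ 3 + W * (b ^ 4 + d ^ 2) / v ^ 2.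
Proof.
  intros Hp S0 S1 S2 S3 Hb Hv Hd HW1 HW2.
  pose proof (sqrt_lt_R0 v Hv) as Hs. set (s := sqrt v) in *.
  assert (Hs2 : s ^ 2 = v) by (unfold s; rewrite <- Rsqr_pow2; apply Rsqr_sqrt; lra).
  assert (HW0 : 0 <= W).
  { apply Rle_trans with (2 := HW2 v ltac:(lra)). apply Rabs_pos. }
  set (z := w / s) in *.
  set (T := fun a => Phi z + (- X a / s) * Phi1 z + (- X a / s) ^ 2 / 2 * Phi2 z
                     + (- X a / s) ^ 3 / 6 * Phi3 z).
  (* The mean removes the first order term, and the second order term is exactly the linear term of
     the variance expansion in [Phi_var_taylor]. What survives is the third moment. *)
  assert (ET : lsum l (fun a => p a * T a)
               = Phi z + d * (Phi2 z / (2 * v)) - m / s ^ 3 / 6 * Phi3 z).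
  { rewrite (lsum_ext l _ (fun a => Phi z * p a + (- Phi1 z / s) * (p a * X a)
        + (Phi2 z / (2 * s ^ 2)) * (p a * X a ^ 2) + (- Phi3 z / (6 * s ^ 3)) * (p a * X a ^ 3))).
    2:{ intros a _. unfold T. field. lra. }
    rewrite !lsum_plus, !lsum_scal, S0, S1, S2, S3, Hs2. field. lra. }
  assert (E1 : Rabs (lsum l (fun a => p a * Phi ((w - X a) / s)) - lsum l (fun a => p a * T a))
                 <= W * b ^ 4 / (24 * v ^ 2)).
  { rewrite <- lsum_minus. apply Rle_trans with (1 := lsum_Rabs _ _).
    replace (W * b ^ 4 / (24 * v ^ 2)) with (W * b ^ 4 / (24 * v ^ 2) * lsum l p) by (rewrite S0; ring).
    rewrite <- lsum_scal. apply lsum_le. intros a Ha.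
    rewrite <- Rmult_minus_distr_l, Rabs_mult, (Rabs_pos_eq (p a)), (Rmult_comm _ (p a)) by now apply Hp.
    apply Rmult_le_compat_l; [now apply Hp|].
    specialize (Hb a Ha).
    replace ((w - X a) / s) with (z + - X a / s) by (unfold z; field; lra).
    apply Rle_trans with (W * (- X a / s) ^ 4 / 24).
    - apply Phi_taylor. intros t Ht.
      replace (t * (- X a / s)) with ((- (t * X a)) / s) by (field; lra).
      apply HW1. rewrite Rabs_Ropp, Rabs_mult, (Rabs_pos_eq t) by lra.
      pose proof (Rabs_pos (X a)). nra.
    - replace ((- X a / s) ^ 4) with (X a ^ 4 / v ^ 2) by (rewrite <- Hs2; field; lra).
      pose proof (pow4_le_Rabs _ _ Hb).
      replace (W * (X a ^ 4 / v ^ 2) / 24) with (W / (24 * v ^ 2) * X a ^ 4) by (field; lra).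
      replace (W * b ^ 4 / (24 * v ^ 2)) with (W / (24 * v ^ 2) * b ^ 4) by (field; lra).
      apply Rmult_le_compat_l; [|easy]. apply Rmult_le_pos; [easy|].
      left. apply Rinv_0_lt_compat. nra. }
  assert (E2 := Phi_var_taylor w v d W Hv Hd HW2). fold s in E2. fold z in E2.
  rewrite ET in E1.
  assert (E3 : Rabs (m / s ^ 3 / 6 * Phi3 z) <= Rabs m / s ^ 3).
  { assert (0 < s ^ 3) by now apply pow_lt.
    assert (0 <= Rabs m / s ^ 3).
    { apply Rmult_le_pos; [apply Rabs_pos|left; now apply Rinv_0_lt_compat]. }
    replace (m / s ^ 3 / 6 * Phi3 z) with (m / s ^ 3 * (Phi3 z / 6)) by (field; lra).
    rewrite Rabs_mult. rewrite Rabs_div by lra. rewrite (Rabs_pos_eq (s ^ 3)) by lra.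
    assert (Rabs (Phi3 z / 6) <= 1).
    { rewrite Rabs_div by lra. rewrite (Rabs_pos_eq 6) by lra. pose proof (Phi3_bound z). lra. }
    nra. }
  set (L := lsum l _) in *.
  assert (HWv : 0 <= W / v ^ 2).
  { apply Rmult_le_pos; [easy|]. left. apply Rinv_0_lt_compat. nra. }
  assert (W * (b ^ 4 + d ^ 2) / v ^ 2 = (W / v ^ 2) * b ^ 4 + (W / v ^ 2) * d ^ 2) as -> by (field; lra).
  assert (W * b ^ 4 / (24 * v ^ 2) = (W / v ^ 2) * b ^ 4 / 24) as Q1 by (field; lra).
  assert (W * d ^ 2 / (8 * v ^ 2) = (W / v ^ 2) * d ^ 2 / 8) as Q2 by (field; lra).
  rewrite Q1 in E1. rewrite Q2 in E2.
  pose proof (pow4_nonneg b). pose proof (pow2_ge_0 d).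
  assert (0 <= (W / v ^ 2) * b ^ 4) by (apply Rmult_le_pos; easy).
  assert (0 <= (W / v ^ 2) * d ^ 2) by (apply Rmult_le_pos; easy).
  apply Rabs_le_between in E1.
  apply Rabs_le_between in E2. apply Rabs_le_between in E3.
  apply Rabs_le_between. lra.
Qed.

(** For the exceptional partitions, whose jumps may exceed sqrt v, so that no single envelope value
    controls the fourth derivative. *)
Lemma jump_vs_heat_crude {A : Type} (l : list A) (p X : A -> R) (w v d m b : R) :
  (forall a, In a l -> 0 <= p a) -> lsum l p = 1 ->
  lsum l (fun a => p a * X a) = 0 -> lsum l (fun a => p a * X a ^ 2) = d ->
  lsum l (fun a => p a * X a ^ 3) = m ->
  (forall a, In a l -> Rabs (X a) <= b) -> 0 < v -> 0 <= d ->
  Rabs (lsum l (fun a => p a * Phi ((w - X a) / sqrt v)) - Phi (w / sqrt (v + d)))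
    <= Rabs m / sqrt v ^ 3 + 32 * (b ^ 4 + d ^ 2) / v ^ 2.
Proof. intros. eapply jump_vs_heat; eauto; intros; apply Phi4_bound_const. Qed.

(** The bounds on [b] and [d] keep the argument within distance 1 of [w / sqrt v] and the variance
    within a factor 2, so the envelope at this one point controls the fourth derivative along both
    expansions. *)
Lemma jump_vs_heat_env {A : Type} (l : list A) (p X : A -> R) (w v d m b : R) :
  (forall a, In a l -> 0 <= p a) -> lsum l p = 1 ->
  lsum l (fun a => p a * X a) = 0 -> lsum l (fun a => p a * X a ^ 2) = d ->
  lsum l (fun a => p a * X a ^ 3) = m ->
  (forall a, In a l -> Rabs (X a) <= b) -> 0 < v -> 0 <= d ->
  b <= sqrt v -> d <= v ->
  Rabs (lsum l (fun a => p a * Phi ((w - X a) / sqrt v)) - Phi (w / sqrt (v + d)))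
    <= Rabs m / sqrt v ^ 3 + 96 * env (w / sqrt v) * (b ^ 4 + d ^ 2) / v ^ 2.
Proof.
  intros Hp S0 S1 S2 S3 Hb Hv Hd Hbv Hdv. pose proof (sqrt_lt_R0 v Hv).
  eapply jump_vs_heat; eauto.
  - intros x Hx. apply Phi4_env. set (z := w / sqrt v).
    assert (Q : Rabs (x / sqrt v) <= 1).
    { rewrite Rabs_div by lra. rewrite (Rabs_pos_eq (sqrt v)) by lra.
      apply (Rmult_le_reg_r (sqrt v)); [easy|]. unfold Rdiv. rewrite Rmult_assoc, Rinv_l by lra. lra. }
    apply Rabs_le_between in Q. set (h := x / sqrt v) in *.
    (* Equivalent to (z + h)^2 >= z^2 / 2 - h^2. *)
    assert (0 <= (z + 2 * h) ^ 2) by apply pow2_ge_0. nra.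
  - intros u Hu. apply Phi4_env.
    assert (E : forall u, 0 < u -> (w / sqrt u) ^ 2 = w ^ 2 / u).
    { intros u' Hu'. pose proof (sqrt_lt_R0 u' Hu').
      rewrite <- (sqrt_sqrt u') at 2 by lra. field. lra. }
    rewrite !E by lra.
    assert (w ^ 2 / v / 2 <= w ^ 2 / u).
    { replace (w ^ 2 / v / 2) with (w ^ 2 * / (2 * v)) by (field; lra).
      apply Rmult_le_compat_l; [apply pow2_ge_0|]. apply Rinv_le_contravar; lra. }
    lra.
Qed.

(** * Partitions *)

Definition lprod {A : Type} (l : list A) (f : A -> R) : R := prodR (map f l).

Section ListProducts.

Context {A : Type}.
Implicit Types (l : list A) (f g : A -> R).

Lemma lprod_cons a l f : lprod (a :: l) f = f a * lprod l f.
Proof. reflexivity. Qed.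

Lemma lprod_app l l' f : lprod (l ++ l') f = lprod l f * lprod l' f.
Proof. induction l; [unfold lprod; simpl; ring|]. rewrite <- app_comm_cons, !lprod_cons, IHl. ring. Qed.

Lemma lprod_ext l f g : (forall a, In a l -> f a = g a) -> lprod l f = lprod l g.
Proof. intros H. unfold lprod. f_equal. now apply map_ext_in. Qed.

Lemma lprod_mult l f g : lprod l (fun a => f a * g a) = lprod l f * lprod l g.
Proof. induction l; [unfold lprod; simpl; ring|]. rewrite !lprod_cons, IHl. ring. Qed.

Lemma lprod_pos l f : (forall a, In a l -> 0 < f a) -> 0 < lprod l f.
Proof.
  induction l; intros H; [unfold lprod; simpl; lra|]. rewrite lprod_cons.
  apply Rmult_lt_0_compat; [apply H; now left|]. apply IHl. intros; apply H; now right.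
Qed.

Lemma lprod_le l f g : (forall a, In a l -> 0 <= f a <= g a) -> 0 <= lprod l f <= lprod l g.
Proof.
  induction l; intros H; [unfold lprod; simpl; lra|]. rewrite !lprod_cons.
  destruct (H a (or_introl eq_refl)).
  destruct IHl; [intros; apply H; now right|]. split; [nra|]. now apply Rmult_le_compat.
Qed.

Lemma lprod_replace l f g c :
  NoDup l -> In c l -> (forall a, a <> c -> f a = g a) -> lprod l f * g c = lprod l g * f c.
Proof.
  intros Hl Hc H. destruct (in_split c l Hc) as (l1 & l2 & ->).
  apply NoDup_remove_2 in Hl. rewrite in_app_iff in Hl.
  rewrite !lprod_app, !lprod_cons.
  rewrite (lprod_ext l1 f g), (lprod_ext l2 f g); [ring| |];
    intros a Ha; apply H; intros ->; tauto.
Qed.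

End ListProducts.

Lemma lprod_telescope (f : nat -> R) (s d : nat) :
  (forall c, (s <= c <= s + d)%nat -> f c <> 0) ->
  lprod (seq s d) (fun c => f c / f (S c)) = f s / f (s + d)%nat.
Proof.
  revert s. induction d; intros s H.
  - unfold lprod. simpl. rewrite Nat.add_0_r. field. apply H. lia.
  - simpl seq. rewrite lprod_cons, IHd by (intros; apply H; lia).
    replace (S s + d)%nat with (s + S d)%nat by lia. field. split; apply H; lia.
Qed.

Lemma NoDup_flat_map_map {A B C : Type} (h : A -> B -> C) (g : A -> list B) (l : list A) :
  (forall a a' b b', h a b = h a' b' -> a = a' /\ b = b') ->
  NoDup l -> (forall a, In a l -> NoDup (g a)) -> NoDup (flat_map (fun a => map (h a) (g a)) l).
Proof.
  intros Hi Hl Hg. induction Hl as [|a l Ha Hl IH]; [constructor|]. simpl.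
  apply NoDup_app.
  - apply FinFun.Injective_map_NoDup; [|apply Hg; now left].
    intros b b' E. now apply Hi in E.
  - apply IH. intros; apply Hg; now right.
  - intros c Hc1 Hc2. rewrite in_map_iff in Hc1. destruct Hc1 as (b & <- & _).
    rewrite in_flat_map in Hc2. destruct Hc2 as (a' & Ha' & Hc2).
    rewrite in_map_iff in Hc2. destruct Hc2 as (b' & E & _). apply Hi in E as [-> _]. easy.
Qed.

(** The bound [m] on the first row makes the notion structural: once a row r is peeled off, r is the
    bound for the rest. All inductions on partitions use this. *)
Fixpoint is_partition (m : nat) (l : list nat) : Prop :=
  match l with
  | [] => True
  | r :: mu => (1 <= r <= m)%nat /\ is_partition r mu
  end.

Lemma is_partition_le (m m' : nat) (l : list nat) :
  (m <= m')%nat -> is_partition m l -> is_partition m' l.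
Proof. destruct l; simpl; [easy|]. intros H1 [H2 H3]. split; [lia|easy]. Qed.

Lemma in_parts (fuel m n : nat) (l : list nat) : (n <= fuel)%nat ->
  In l (parts fuel m n) <-> is_partition m l /\ list_sum l = n.
Proof.
  revert m n l. induction fuel; intros m n l Hn.
  - assert (n = 0)%nat as -> by lia. simpl. destruct l as [|r mu]; simpl; [tauto|].
    split; [intros [|[]]; discriminate|]. intros [[H _] H']. lia.
  - simpl. destruct (Nat.eqb_spec n 0) as [->|Hn0].
    + simpl. destruct l as [|r mu]; simpl; [tauto|].
      split; [intros [|[]]; discriminate|]. intros [[H _] H']. lia.
    + rewrite in_flat_map. split.
      * intros (p & Hp & Hl). rewrite in_map_iff in Hl. destruct Hl as (mu & <- & Hmu).
        rewrite in_seq in Hp. apply IHfuel in Hmu; [|lia]. simpl. destruct Hmu.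
        repeat split; (easy || lia).
      * destruct l as [|r mu]; simpl; [intros [_ H]; lia|]. intros [[Hr Hmu] Hs].
        exists r. rewrite in_seq, in_map_iff. split; [lia|]. exists mu. split; [easy|].
        apply IHfuel; [lia|]. split; [easy|lia].
Qed.

Lemma NoDup_parts (fuel m n : nat) : NoDup (parts fuel m n).
Proof.
  revert m n. induction fuel; intros m n; simpl; destruct (Nat.eqb n 0);
    try (repeat constructor; easy).
  apply NoDup_flat_map_map with (h := @cons nat).
  - intros a a' b b' E. now injection E.
  - apply seq_NoDup.
  - intros; apply IHfuel.
Qed.

Lemma in_partitions (n : nat) (l : list nat) :
  In l (partitions n) <-> is_partition n l /\ list_sum l = n.
Proof. now apply in_parts. Qed.

Fixpoint add_box (l : list nat) (k : nat) : list nat :=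
  match l, k with
  | [], _ => [1%nat]
  | r :: mu, O => S r :: mu
  | r :: mu, S k' => r :: add_box mu k'
  end.

(* A row of length 1 is removable only when it is the last one. *)
Fixpoint remove_box (l : list nat) (k : nat) : list nat :=
  match l, k with
  | [], _ => []
  | S (S r) :: mu, O => S r :: mu
  | _ :: mu, O => []
  | r :: mu, S k' => r :: remove_box mu k'
  end.

(* Row [k] of [l] may be lengthened, the first row staying at most [m]. *)
Fixpoint addable (m : nat) (l : list nat) (k : nat) : bool :=
  match l, k with
  | [], O => Nat.ltb 0 m
  | [], S _ => false
  | r :: mu, O => Nat.ltb r m
  | r :: mu, S k' => addable r mu k'
  end.

Fixpoint removable (l : list nat) (k : nat) : bool :=
  match l, k with
  | [], _ => false
  | r :: mu, O => Nat.ltb (hd 0%nat mu) r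
  | r :: mu, S k' => removable mu k'
  end.

Lemma add_box_spec (m : nat) (l : list nat) (k : nat) :
  is_partition m l -> addable m l k = true ->
  is_partition m (add_box l k) /\ removable (add_box l k) k = true /\
  remove_box (add_box l k) k = l /\ list_sum (add_box l k) = S (list_sum l) /\
  (k < length (add_box l k))%nat /\ (k <= length l)%nat.
Proof.
  revert m k. induction l as [|r mu IH]; intros m k P H.
  - destruct k; [|discriminate]. simpl in *. apply Nat.ltb_lt in H. repeat split; lia.
  - destruct k as [|k].
    + simpl in *. apply Nat.ltb_lt in H. destruct P as [Hr P].
      repeat split; try lia.
      * now apply is_partition_le with r; [lia|].
      * apply Nat.ltb_lt. destruct mu; simpl in *; lia.
      * destruct r; [lia|easy].
    + simpl in H. destruct P as [Hr P]. destruct (IH r k P H) as (H1 & H2 & H3 & H4 & H5 & H6).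
      simpl. rewrite H3, H4. repeat split; try easy; try lia.
      destruct r as [|[|r]]; easy.
Qed.

Lemma remove_box_spec (m : nat) (l : list nat) (k : nat) :
  is_partition m l -> removable l k = true ->
  is_partition m (remove_box l k) /\ addable m (remove_box l k) k = true /\
  add_box (remove_box l k) k = l /\ list_sum l = S (list_sum (remove_box l k)).
Proof.
  revert m k. induction l as [|r mu IH]; intros m k P H; [discriminate|].
  destruct P as [Hr P]. destruct k as [|k].
  - simpl in H. apply Nat.ltb_lt in H. destruct r as [|[|r]]; [lia| |].
    + destruct mu as [|s nu]; simpl in *; [|lia].
      repeat split. apply Nat.ltb_lt. lia.
    + simpl. repeat split; try lia; try (apply Nat.ltb_lt; lia).
      destruct mu as [|s nu]; simpl in *; [easy|]. split; [lia|easy].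
  - simpl in H. destruct (IH r k P H) as (H1 & H2 & H3 & H4).
    assert (E : remove_box (r :: mu) (S k) = r :: remove_box mu k) by (destruct r as [|[|r]]; easy).
    rewrite E. simpl. rewrite H3, H4. repeat split; easy || lia.
Qed.

Lemma col_len_cons (r : nat) (mu : list nat) (c : nat) :
  col_len (r :: mu) c = ((if Nat.ltb c r then 1 else 0) + col_len mu c)%nat.
Proof. unfold col_len. simpl. now destruct (Nat.ltb c r). Qed.

Lemma col_len_large (m : nat) (l : list nat) (c : nat) :
  is_partition m l -> (m <= c)%nat -> col_len l c = 0%nat.
Proof.
  revert m. induction l as [|r mu IH]; intros m P H; [easy|]. destruct P as [Hr P].
  rewrite col_len_cons, (IH r P) by lia. destruct (Nat.ltb_spec c r); lia.
Qed.

Lemma addable_row (m : nat) (l : list nat) (k : nat) :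
  is_partition m l -> addable m l k = true ->
  (nth k l 0 < m)%nat /\ nth k (add_box l k) 0%nat = S (nth k l 0%nat) /\
  col_len l (nth k l 0%nat) = k /\ col_len (add_box l k) (nth k l 0%nat) = S k /\
  forall c, c <> nth k l 0%nat -> col_len (add_box l k) c = col_len l c.
Proof.
  revert m k. induction l as [|r mu IH]; intros m k P H.
  - destruct k; [|discriminate]. simpl in *. apply Nat.ltb_lt in H.
    repeat split; [easy|]. intros c Hc. rewrite col_len_cons.
    destruct (Nat.ltb_spec c 1); [lia|easy].
  - destruct P as [Hr P]. destruct k as [|k].
    + simpl in *. apply Nat.ltb_lt in H. pose proof (col_len_large r mu r P (le_n r)) as E.
      repeat split; [easy| | |].
      * rewrite col_len_cons, E, Nat.ltb_irrefl. easy.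
      * rewrite col_len_cons, E. destruct (Nat.ltb_spec r (S r)); lia.
      * intros c Hc. rewrite !col_len_cons.
        destruct (Nat.ltb_spec c (S r)), (Nat.ltb_spec c r); lia.
    + simpl in H. destruct (IH r k P H) as (H1 & H2 & H3 & H4 & H5). simpl.
      repeat split; [lia|easy| | |].
      * rewrite col_len_cons, H3. destruct (Nat.ltb_spec (nth k mu 0%nat) r); lia.
      * rewrite col_len_cons, H4. destruct (Nat.ltb_spec (nth k mu 0%nat) r); lia.
      * intros c Hc. rewrite !col_len_cons, H5; easy.
Qed.

Lemma nth_le_partition (m : nat) (l : list nat) (k : nat) :
  is_partition m l -> (nth k l 0 <= m)%nat.
Proof.
  revert m k. induction l as [|r mu IH]; intros m k P; [destruct k; simpl; lia|].
  destruct P as [Hr P]. destruct k; simpl; [lia|]. specialize (IH r k P). lia.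
Qed.

(** * The growth process of the Jack measure *)

Section Jack.

Variable alpha : R.
Hypothesis halpha : 1 <= alpha.

Definition hook (a l : nat) : R :=
  (alpha * INR a + INR l + 1) * (alpha * INR a + INR l + alpha).

Lemma hook_pos (a l : nat) : 0 < hook a l.
Proof. unfold hook. pose proof (pos_INR a). pose proof (pos_INR l). apply Rmult_lt_0_compat; nra. Qed.

Definition row_hook (r : nat) (mu : list nat) : R :=
  lprod (seq 0 r) (fun c => hook (r - 1 - c) (col_len mu c)).

Lemma row_hook_pos (r : nat) (mu : list nat) : 0 < row_hook r mu.
Proof. apply lprod_pos. intros; apply hook_pos. Qed.

(** A row put on top changes no arm or leg below it: column lengths and row indices both grow by 1,
    and legs are their differences. *)
Lemma hook_product_cons (r : nat) (mu : list nat) :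
  is_partition r mu -> hook_product alpha (r :: mu) = row_hook r mu * hook_product alpha mu.
Proof.
  intros P. unfold hook_product. simpl length. rewrite <- cons_seq, <- seq_shift. simpl map at 1.
  change (prodR (?a :: ?l)) with (a * prodR l). f_equal.
  - apply lprod_ext. intros c Hc. apply in_seq in Hc. unfold hook. rewrite col_len_cons.
    destruct (Nat.ltb_spec c r); [|lia].
    replace (r - c - 1)%nat with (r - 1 - c)%nat by lia.
    replace (1 + col_len mu c - 0 - 1)%nat with (col_len mu c) by lia. reflexivity.
  - rewrite map_map. f_equal. apply map_ext_in. intros i Hi. simpl nth.
    f_equal. apply map_ext_in. intros c Hc. apply in_seq in Hc.
    pose proof (nth_le_partition r mu i P). rewrite col_len_cons.
    destruct (Nat.ltb_spec c r); [|lia].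
    replace (1 + col_len mu c - S i - 1)%nat with (col_len mu c - i - 1)%nat by lia. reflexivity.
Qed.

Lemma hook_product_pos (m : nat) (l : list nat) : is_partition m l -> 0 < hook_product alpha l.
Proof.
  revert m. induction l as [|r mu IH]; intros m P.
  - unfold hook_product. simpl. lra.
  - destruct P as [Hr P]. rewrite hook_product_cons by easy.
    apply Rmult_lt_0_compat; [apply row_hook_pos|now apply (IH r)].
Qed.

(* With [x_i] the content of the box to be added in row [i], this is
   [prod_(i <= N) (z - x_i) / prod_(i < N) (z - x_i + 1)] where [N = length l]. Its reciprocal is
   the Cauchy transform of the transition measure of [l]. *)
Fixpoint interlacing (l : list nat) (z : R) : R :=
  match l with
  | [] => z
  | r :: mu => interlacing mu (z + 1) * ((z - alpha * INR r) / (z + 1 - alpha * INR r))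
  end.

Definition content (l : list nat) (k : nat) : R := alpha * INR (nth k l 0%nat) - INR k.

(* Row [length l] is a new row; rows that cannot be lengthened get probability 0. *)
Fixpoint up_prob (l : list nat) (k : nat) : R :=
  match l, k with
  | [], _ => 1
  | r :: mu, O => / interlacing mu (alpha * INR r + 1)
  | r :: mu, S k' => up_prob mu k' *
      ((content mu k' - alpha * INR r) / (content mu k' - 1 - alpha * INR r))
  end.

(* [alpha * n] times the probability that row [k] is the one shortened. *)
Fixpoint down_rate (l : list nat) (k : nat) : R :=
  match l, k with
  | [], _ => 0
  | r :: mu, O => interlacing mu (alpha * INR r)
  | r :: mu, S k' => down_rate mu k' *
      ((content mu k' - 2 - alpha * INR r) / (content mu k' - 1 - alpha * INR r))
  end.

Lemma content_cons (r : nat) (mu : list nat) (k : nat) :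
  content (r :: mu) (S k) = content mu k - 1.
Proof. unfold content. simpl nth. rewrite S_INR. ring. Qed.

Lemma content_0 (r : nat) (mu : list nat) : content (r :: mu) 0 = alpha * INR r.
Proof. unfold content. simpl. ring. Qed.

Lemma content_le (m : nat) (l : list nat) (k : nat) :
  is_partition m l -> content l k <= alpha * INR m.
Proof.
  intros P. unfold content. pose proof (le_INR _ _ (nth_le_partition m l k P)).
  pose proof (pos_INR k). nra.
Qed.

Lemma interlacing_pos (m : nat) (l : list nat) (z : R) :
  is_partition m l -> alpha * INR m < z -> 0 < interlacing l z.
Proof.
  revert m z. induction l as [|r mu IH]; intros m z P Hz.
  - simpl. pose proof (pos_INR m). nra.
  - destruct P as [Hr P]. pose proof (le_INR r m ltac:(lia)). simpl.
    apply Rmult_lt_0_compat; [apply (IH r); [easy|nra]|].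
    apply Rdiv_lt_0_compat; nra.
Qed.

Lemma up_prob_nonneg (m : nat) (l : list nat) (k : nat) : is_partition m l -> 0 <= up_prob l k.
Proof.
  revert m k. induction l as [|r mu IH]; intros m k P; [simpl; lra|].
  destruct P as [Hr P]. destruct k as [|k]; simpl.
  - left. apply Rinv_0_lt_compat. apply (interlacing_pos r); [easy|lra].
  - apply Rmult_le_pos; [now apply (IH r)|]. pose proof (content_le r mu k P).
    replace ((content mu k - alpha * INR r) / (content mu k - 1 - alpha * INR r))
      with ((alpha * INR r - content mu k) / (alpha * INR r + 1 - content mu k)) by (field; lra).
    apply Rmult_le_pos; [lra|]. left. apply Rinv_0_lt_compat. lra.
Qed.

(** Partial fractions: the transition probabilities are the residues of 1 / [interlacing] at the
    contents of the addable boxes. The condition on z keeps it to the right of all poles. *)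
Lemma up_prob_cauchy (m : nat) (l : list nat) (z : R) :
  is_partition m l -> alpha * INR m < z ->
  lsum (seq 0 (S (length l))) (fun k => up_prob l k / (z - content l k)) = / interlacing l z.
Proof.
  revert m z. induction l as [|r mu IH]; intros m z P Hz.
  - unfold lsum, content. simpl. pose proof (pos_INR m). assert (0 <= alpha * INR m) by nra. field. lra.
  - destruct P as [Hr P]. pose proof (le_INR r m ltac:(lia)).
    simpl length. rewrite lsum_seq_S.
    (* The second summand adds up, by induction at [alpha * INR r + 1], to the negative of the term
       of the first row. *)
    rewrite (lsum_ext _ _ (fun k =>
      ((z + 1 - alpha * INR r) / (z - alpha * INR r)) * (up_prob mu k / (z + 1 - content mu k))
      + (- / (z - alpha * INR r)) * (up_prob mu k / (alpha * INR r + 1 - content mu k)))).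
    2:{ intros k _. rewrite content_cons. simpl. pose proof (content_le r mu k P).
        field. repeat split; nra. }
    rewrite lsum_plus, !lsum_scal, (IH r), (IH r) by (easy || nra).
    rewrite content_0. simpl.
    pose proof (interlacing_pos r mu (alpha * INR r + 1) P ltac:(lra)).
    pose proof (interlacing_pos r mu (z + 1) P ltac:(nra)).
    field. repeat split; nra.
Qed.

(** Transfers a moment from [r :: mu] to [mu]. With y = x - 1 and c = [alpha * INR r], the condition
    says h(x) = g(y) + (g(y) - g(c)) / (y - c), so a polynomial g gives a polynomial h of the same
    degree. The term of the first row is absorbed through [up_prob_cauchy] at c + 1. *)
Lemma up_sum_cons (r : nat) (mu : list nat) (g h : R -> R) :
  is_partition r mu ->
  (forall x, x <= alpha * INR r ->
     (x - alpha * INR r) / (x - 1 - alpha * INR r) * g (x - 1)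
       = h x - g (alpha * INR r) / (alpha * INR r + 1 - x)) ->
  lsum (seq 0 (S (length (r :: mu)))) (fun k => up_prob (r :: mu) k * g (content (r :: mu) k))
  = lsum (seq 0 (S (length mu))) (fun k => up_prob mu k * h (content mu k)).
Proof.
  intros P H. simpl length. rewrite lsum_seq_S, content_0.
  rewrite (lsum_ext _ _ (fun k => up_prob mu k * h (content mu k)
     - g (alpha * INR r) * (up_prob mu k / (alpha * INR r + 1 - content mu k)))).
  2:{ intros k _. rewrite content_cons. simpl. pose proof (content_le r mu k P) as Hc.
      rewrite Rmult_assoc, H by easy. field. lra. }
  rewrite lsum_minus, lsum_scal, (up_prob_cauchy r) by (easy || lra). simpl. ring.
Qed.

Lemma up_sum_0 (m : nat) (l : list nat) : is_partition m l ->
  lsum (seq 0 (S (length l))) (up_prob l) = 1.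
Proof.
  intros P. rewrite (lsum_ext _ _ (fun k => up_prob l k * 1))
    by (intros; ring).
  revert m P. induction l as [|r mu IH]; intros m P; [unfold lsum; simpl; ring|].
  destruct P as [Hr P]. rewrite (up_sum_cons r mu (fun _ => 1) (fun _ => 1)); [now apply (IH r)|easy|].
  intros x Hx. field. lra.
Qed.

Lemma up_sum_1 (m : nat) (l : list nat) : is_partition m l ->
  lsum (seq 0 (S (length l))) (fun k => up_prob l k * content l k) = 0.
Proof.
  revert m. induction l as [|r mu IH]; intros m P; [unfold lsum, content; simpl; ring|].
  destruct P as [Hr P]. rewrite (up_sum_cons r mu (fun x => x) (fun x => x)); [now apply (IH r)|easy|].
  intros x Hx. field. lra.
Qed.

Lemma up_sum_2 (m : nat) (l : list nat) : is_partition m l ->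
  lsum (seq 0 (S (length l))) (fun k => up_prob l k * content l k ^ 2) = alpha * INR (list_sum l).
Proof.
  revert m. induction l as [|r mu IH]; intros m P; [unfold lsum, content; simpl; ring|].
  destruct P as [Hr P].
  (* The constant of h is the contribution [alpha * INR r] of the first row to the variance. *)
  rewrite (up_sum_cons r mu (fun x => x ^ 2) (fun x => x ^ 2 - x + alpha * INR r)); [|easy|].
  - rewrite (lsum_ext _ _ (fun k => up_prob mu k * content mu k ^ 2
        + (-1) * (up_prob mu k * content mu k) + (alpha * INR r) * up_prob mu k)) by (intros; ring).
    rewrite !lsum_plus, !lsum_scal, (IH r), (up_sum_1 r), (up_sum_0 r) by easy.
    simpl list_sum. rewrite plus_INR. ring.
  - intros x Hx. field. lra.
Qed.

(* The sum of the [alpha]-contents [alpha * j - i] of the boxes [(i, j)]. *)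
Fixpoint content_sum (l : list nat) : R :=
  match l with
  | [] => 0
  | r :: mu => alpha * binom2 r + content_sum mu - INR (list_sum mu)
  end.

(** The first moment to depend on more than the size of the partition; this is why the third moment
    is later bounded in mean only. *)
Lemma up_sum_3 (m : nat) (l : list nat) : is_partition m l ->
  lsum (seq 0 (S (length l))) (fun k => up_prob l k * content l k ^ 3)
  = 2 * alpha * content_sum l + alpha * (alpha - 1) * INR (list_sum l).
Proof.
  revert m. induction l as [|r mu IH]; intros m P; [unfold lsum, content; simpl; ring|].
  destruct P as [Hr P].
  rewrite (up_sum_cons r mu (fun x => x ^ 3)
    (fun x => x ^ 3 - 2 * x ^ 2 + (1 + alpha * INR r) * x + ((alpha * INR r) ^ 2 - alpha * INR r))); [|easy|].
  - rewrite (lsum_ext _ _ (fun k => up_prob mu k * content mu k ^ 3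
        + (-2) * (up_prob mu k * content mu k ^ 2) + (1 + alpha * INR r) * (up_prob mu k * content mu k)
        + ((alpha * INR r) ^ 2 - alpha * INR r) * up_prob mu k)) by (intros; ring).
    rewrite !lsum_plus, !lsum_scal, (IH r), (up_sum_2 r), (up_sum_1 r), (up_sum_0 r) by easy.
    simpl list_sum. simpl content_sum. unfold binom2. rewrite plus_INR. field.
  - intros x Hx. field. lra.
Qed.

Lemma content_sum_add_box (m : nat) (l : list nat) (k : nat) :
  is_partition m l -> addable m l k = true ->
  content_sum (add_box l k) = content_sum l + content l k.
Proof.
  revert m k. induction l as [|r mu IH]; intros m k P H.
  - destruct k; [|discriminate]. unfold content, binom2. simpl. unfold binom2. simpl. field.
  - destruct P as [Hr P]. destruct k as [|k].
    + rewrite content_0. simpl. unfold binom2. rewrite S_INR. field.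
    + rewrite content_cons. simpl in *.
      destruct (add_box_spec r mu k P H) as (_ & _ & _ & E & _).
      rewrite (IH r) by easy. rewrite E, S_INR. ring.
Qed.

(** The dual partial fraction expansion, of [interlacing] itself, with the down rates as residues.
    Equality of z with the bound is allowed because the first row's rate is a value at exactly such
    a point. *)
Lemma interlacing_down (m : nat) (l : list nat) (z : R) :
  is_partition m l -> alpha * INR m <= z ->
  interlacing l z = z - lsum (seq 0 (length l)) (fun k => down_rate l k / (z + 1 - content l k)).
Proof.
  revert m z. induction l as [|r mu IH]; intros m z P Hz; [unfold lsum; simpl; ring|].
  destruct P as [Hr P]. pose proof (le_INR r m ltac:(lia)) as Hrm.
  simpl length. rewrite lsum_seq_S, content_0.
  rewrite (lsum_ext _ _ (fun k =>
      ((z - alpha * INR r) / (z + 1 - alpha * INR r)) * (down_rate mu k / (z + 1 + 1 - content mu k))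
      + (/ (z + 1 - alpha * INR r)) * (down_rate mu k / (alpha * INR r + 1 - content mu k)))).
  2:{ intros k _. rewrite content_cons. simpl. pose proof (content_le r mu k P).
      field. repeat split; nra. }
  rewrite lsum_plus, !lsum_scal. simpl.
  rewrite (IH r (z + 1)), (IH r (alpha * INR r)) by (easy || nra).
  field. nra.
Qed.

Lemma down_rate_sum (m : nat) (l : list nat) : is_partition m l ->
  lsum (seq 0 (length l)) (down_rate l) = alpha * INR (list_sum l).
Proof.
  revert m. induction l as [|r mu IH]; intros m P; [unfold lsum; simpl; ring|].
  destruct P as [Hr P]. simpl length. rewrite lsum_seq_S.
  rewrite (lsum_ext _ _ (fun k => down_rate mu k
      + down_rate mu k / (alpha * INR r + 1 - content mu k))).
  2:{ intros k _. simpl. pose proof (content_le r mu k P). field. lra. }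
  rewrite lsum_plus, (IH r) by easy. simpl.
  rewrite (interlacing_down r) by (easy || lra). rewrite plus_INR. ring.
Qed.

(** A row as long as the one above it acquires a vanishing factor. The exception is a first row
    stopped by the cap [m]; with cap n + 1 for partitions of n it does not occur. *)
Lemma up_prob_not_addable (m : nat) (l : list nat) (k : nat) :
  is_partition m l -> (k <= length l)%nat -> addable m l k = false ->
  up_prob l k = 0 \/ (k = 0%nat /\ nth 0 l 0%nat = m).
Proof.
  revert m k. induction l as [|r mu IH]; intros m k P Hk H.
  - simpl in Hk. assert (k = 0%nat) as -> by lia. right. simpl in *.
    apply Nat.ltb_ge in H. lia.
  - destruct P as [Hr P]. destruct k as [|k].
    + right. simpl in *. apply Nat.ltb_ge in H. lia.
    + left. simpl in *. destruct (IH r k P ltac:(lia) H) as [E|[-> E]].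
      * rewrite E. ring.
      * unfold content. rewrite E. simpl. rewrite Rminus_0_r. unfold Rdiv. ring.
Qed.

Lemma down_rate_not_removable (m : nat) (l : list nat) (k : nat) :
  is_partition m l -> removable l k = false -> down_rate l k = 0.
Proof.
  revert m k. induction l as [|r mu IH]; intros m k P H; [reflexivity|].
  destruct P as [Hr P]. destruct k as [|k]; simpl in *.
  - apply Nat.ltb_ge in H. destruct mu as [|s nu]; simpl in *; [lia|].
    assert (s = r) as -> by lia. unfold Rdiv. ring.
  - rewrite (IH r) by easy. ring.
Qed.

(** Within a block of columns of equal length the product telescopes, so only the corners of the
    shape survive. In the induction, the columns under the next row carry one extra unit, which
    shifts u to u + 1, and the others are empty. *)
Lemma row_ratio (m : nat) (mu : list nat) (u : R) :
  is_partition m mu -> alpha * INR m < u ->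
  lprod (seq 0 m) (fun c => (u - alpha * INR c + INR (col_len mu c))
                            / (u - alpha * INR (S c) + INR (col_len mu c)))
  = interlacing mu u / (u - alpha * INR m).
Proof.
  revert m u. induction mu as [|s nu IH]; intros m u P Hu.
  - rewrite (lprod_ext _ _ (fun c => (fun x => u - alpha * INR x) c / (fun x => u - alpha * INR x) (S c)))
      by (intros; simpl col_len; simpl INR at 2 4; now rewrite !Rplus_0_r).
    rewrite lprod_telescope.
    + simpl. rewrite Rmult_0_r, Rminus_0_r. reflexivity.
    + intros c Hc. pose proof (le_INR c m ltac:(lia)). nra.
  - destruct P as [Hs P]. pose proof (le_INR s m ltac:(lia)).
    replace (seq 0 m) with (seq 0 s ++ seq s (m - s))
      by (replace m with (s + (m - s))%nat at 2 by lia; now rewrite seq_app).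
    rewrite lprod_app.
    rewrite (lprod_ext (seq 0 s) _ (fun c => (u + 1 - alpha * INR c + INR (col_len nu c))
                            / (u + 1 - alpha * INR (S c) + INR (col_len nu c)))).
    2:{ intros c Hc. apply in_seq in Hc. rewrite col_len_cons.
        destruct (Nat.ltb_spec c s); [|lia]. rewrite plus_INR. simpl (INR 1). f_equal; ring. }
    rewrite IH by (easy || nra).
    rewrite (lprod_ext (seq s (m - s)) _
       (fun c => (fun x => u - alpha * INR x) c / (fun x => u - alpha * INR x) (S c))).
    2:{ intros c Hc. apply in_seq in Hc. rewrite col_len_cons, (col_len_large s nu) by (easy || lia).
        destruct (Nat.ltb_spec c s); [lia|]. simpl (INR (0 + 0)). now rewrite !Rplus_0_r. }
    rewrite lprod_telescope.
    2:{ intros c Hc. pose proof (le_INR c m ltac:(lia)). nra. }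
    replace (s + (m - s))%nat with m by lia. simpl. field. repeat split; nra.
Qed.

(** Lengthening the row raises each arm by 1; each of the two factors of a hook then yields one
    [row_ratio]. The new box has hook [alpha], which cancels the denominator of the second ratio. *)
Lemma row_hook_S (r : nat) (mu : list nat) : is_partition r mu ->
  row_hook (S r) mu
  = row_hook r mu * interlacing mu (alpha * INR r + 1) * interlacing mu (alpha * INR r + alpha).
Proof.
  intros P. unfold row_hook.
  pose proof (row_ratio r mu (alpha * INR r + 1) P ltac:(lra)) as R1.
  pose proof (row_ratio r mu (alpha * INR r + alpha) P ltac:(lra)) as R2.
  replace (alpha * INR r + 1 - alpha * INR r) with 1 in R1 by ring.
  replace (alpha * INR r + alpha - alpha * INR r) with alpha in R2 by ring.
  rewrite seq_S, lprod_app.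
  rewrite (lprod_ext (seq 0 r) (fun c => hook (S r - 1 - c) (col_len mu c))
    (fun c => hook (r - 1 - c) (col_len mu c) *
       (((alpha * INR r + 1 - alpha * INR c + INR (col_len mu c))
                            / (alpha * INR r + 1 - alpha * INR (S c) + INR (col_len mu c))) *
        ((alpha * INR r + alpha - alpha * INR c + INR (col_len mu c))
                            / (alpha * INR r + alpha - alpha * INR (S c) + INR (col_len mu c)))))).
  2:{ intros c Hc. apply in_seq in Hc. unfold hook.
      replace (S r - 1 - c)%nat with (S (r - 1 - c)) by lia.
      assert (ER : INR r = INR (r - 1 - c) + 1 + INR c).
      { replace r with (S (r - 1 - c) + c)%nat at 1 by lia. now rewrite plus_INR, S_INR. }
      rewrite !S_INR, ER. pose proof (pos_INR (r - 1 - c)). pose proof (pos_INR (col_len mu c)).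
      field. split; nra. }
  rewrite !lprod_mult, R1, R2, lprod_cons. unfold lprod at 2. simpl (prodR _).
  replace (S r - 1 - (0 + r))%nat with 0%nat by lia.
  rewrite (col_len_large r mu) by (easy || lia). unfold hook at 2. simpl INR. field. lra.
Qed.

(** For the first row this is [row_hook_S]. For a lower row, the new box changes a single hook of
    the first row, the one above it, and the change of that hook makes up for the first-row factors
    of [up_prob] and [down_rate]. *)
Lemma hook_detailed_balance (m : nat) (l : list nat) (k : nat) :
  is_partition m l -> addable m l k = true ->
  up_prob l k * hook_product alpha (add_box l k)
  = down_rate (add_box l k) k * hook_product alpha l.
Proof.
  revert m k. induction l as [|r mu IH]; intros m k P H.
  - destruct k; [|discriminate]. unfold hook_product. simpl. ring.
  - destruct P as [Hr P]. destruct k as [|k].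
    + simpl in H. apply Nat.ltb_lt in H. simpl add_box.
      rewrite !hook_product_cons by (easy || now apply (is_partition_le r); [lia|]).
      rewrite row_hook_S by easy. simpl up_prob. simpl down_rate.
      replace (alpha * INR r + alpha) with (alpha * INR (S r)) by (rewrite S_INR; ring).
      pose proof (interlacing_pos r mu (alpha * INR r + 1) P ltac:(lra)).
      change (match r with 0%nat => 1 | S _ => INR r + 1 end) with (INR (S r)). field. lra.
    + simpl in H. destruct (add_box_spec r mu k P H) as (P' & _ & _ & _ & _ & _).
      destruct (addable_row r mu k P H) as (Hc & Hn & Hcol & Hcol' & Hoff).
      change (add_box (r :: mu) (S k)) with (r :: add_box mu k).
      rewrite !hook_product_cons by easy. simpl up_prob. simpl down_rate.
      specialize (IH r k P H).
      set (c := nth k mu 0%nat) in *.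
      assert (RR := lprod_replace (seq 0 r) (fun c => hook (r - 1 - c) (col_len (add_box mu k) c))
         (fun c => hook (r - 1 - c) (col_len mu c)) c (seq_NoDup _ _) ltac:(apply in_seq; lia)).
      cbv beta in RR. rewrite Hcol, Hcol' in RR.
      specialize (RR ltac:(intros a Ha; now rewrite Hoff)).
      fold (row_hook r mu) in RR. fold (row_hook r (add_box mu k)) in RR.
      unfold content. rewrite Hn. fold c.
      assert (ER : INR r = INR (r - 1 - c) + 1 + INR c).
      { replace r with (S (r - 1 - c) + c)%nat at 1 by lia. now rewrite plus_INR, S_INR. }
      unfold hook in RR. rewrite !S_INR in RR. rewrite S_INR, ER.
      set (a := INR (r - 1 - c)) in *.
      assert (0 <= a) by apply pos_INR. pose proof (pos_INR k).
      (* The box of the first row above the new box has arm [a], and its leg grows from k to k + 1.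
         All factors are functions of w. *)
      set (w := alpha * a + INR k) in *. assert (0 <= w) by (unfold w; nra).
      replace (alpha * INR c - INR k - alpha * (a + 1 + INR c)) with (- (w + alpha)) by (unfold w; ring).
      replace (alpha * INR c - INR k - 1 - alpha * (a + 1 + INR c)) with (- (w + alpha + 1)) by (unfold w; ring).
      replace (alpha * (INR c + 1) - INR k - 2 - alpha * (a + 1 + INR c)) with (- (w + 2)) by (unfold w; ring).
      replace (alpha * (INR c + 1) - INR k - 1 - alpha * (a + 1 + INR c)) with (- (w + 1)) by (unfold w; ring).
      replace (alpha * a + (INR k + 1)) with (w + 1) in RR by (unfold w; ring).
      replace (row_hook r (add_box mu k))
        with (row_hook r mu * ((w + 1 + 1) * (w + 1 + alpha)) / ((w + 1) * (w + alpha)))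
        by (rewrite <- RR; field; lra).
      transitivity (up_prob mu k * hook_product alpha (add_box mu k) * row_hook r mu * ((w + 2) / (w + 1)));
        [|rewrite IH]; field; lra.
Qed.

Lemma up_down (n : nat) (l : list nat) (k : nat) :
  is_partition (S n) l -> list_sum l = n -> addable (S n) l k = true ->
  jack_weight alpha n l * up_prob l k
  = jack_weight alpha (S n) (add_box l k) * (down_rate (add_box l k) k / (alpha * INR (S n))).
Proof.
  intros P Hn H. unfold jack_weight.
  pose proof (hook_product_pos _ _ P).
  destruct (add_box_spec _ _ _ P H) as (P' & _).
  pose proof (hook_product_pos _ _ P').
  pose proof (hook_detailed_balance _ _ _ P H) as B.
  assert (0 < INR (S n)) by (apply lt_0_INR; lia).
  replace (up_prob l k) with (down_rate (add_box l k) k * hook_product alpha l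
      / hook_product alpha (add_box l k)) by (rewrite <- B; field; lra).
  rewrite fact_simpl, mult_INR, <- tech_pow_Rmult. field. lra.
Qed.

(** * Expectation under the Jack measure *)

Definition jack_mean (n : nat) (g : list nat -> R) : R :=
  lsum (partitions n) (fun l => jack_weight alpha n l * g l).

(** The edges of Young's lattice between two levels, enumerated from below by addable rows and from
    above by removable ones. *)
Lemma add_box_pairs (n : nat) :
  Permutation
    (map (fun q => (add_box (fst q) (snd q), snd q))
       (flat_map (fun l => map (pair l) (filter (addable (S n) l) (seq 0 (S (length l))))) (partitions n)))
    (flat_map (fun l => map (pair l) (filter (removable l) (seq 0 (length l)))) (partitions (S n))).
Proof.
  assert (M : forall l k, In (l, k) (flat_map (fun l => map (pair l)
      (filter (addable (S n) l) (seq 0 (S (length l))))) (partitions n)) <->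
      is_partition (S n) l /\ list_sum l = n /\ addable (S n) l k = true).
  { intros l k. rewrite in_flat_map. split.
    - intros (l' & Hl & Hk). rewrite in_map_iff in Hk. destruct Hk as (k' & E & Hk).
      injection E as -> ->. rewrite in_partitions in Hl. rewrite filter_In in Hk.
      destruct Hl as [Hl ->]. split; [|easy]. now apply is_partition_le with n; [lia|].
    - intros (P & Hn & H). exists l. rewrite in_partitions, in_map_iff. split.
      + split; [|easy]. destruct l as [|r mu]; [easy|]. simpl in *. split; [lia|easy].
      + exists k. rewrite filter_In, in_seq. destruct (add_box_spec _ _ _ P H) as (_&_&_&_&_&Hk).
        repeat split; (lia || easy). }
  apply NoDup_Permutation.
  - apply NoDup_map_NoDup_ForallPairs.
    + intros [l k] [l' k'] Hl Hl' E. simpl in E. injection E as E ->.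
      apply M in Hl as (P & _ & H). apply M in Hl' as (P' & _ & H').
      destruct (add_box_spec _ _ _ P H) as (_&_&R&_). destruct (add_box_spec _ _ _ P' H') as (_&_&R'&_).
      rewrite <- R, E, R'. easy.
    + apply NoDup_flat_map_map with (h := fun l k => (l, k)).
      * intros a a' b b' E. now injection E.
      * apply NoDup_parts.
      * intros. apply NoDup_filter, seq_NoDup.
  - apply NoDup_flat_map_map with (h := fun l k => (l, k)).
    + intros a a' b b' E. now injection E.
    + apply NoDup_parts.
    + intros. apply NoDup_filter, seq_NoDup.
  - intros [L k]. rewrite in_map_iff, in_flat_map. split.
    + intros ([l k'] & E & Hl). simpl in E. injection E as <- ->. apply M in Hl as (P & Hn & H).
      destruct (add_box_spec _ _ _ P H) as (H1&H2&H3&H4&H5&_).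
      exists (add_box l k). rewrite in_partitions, in_map_iff. split; [split; [easy|lia]|].
      exists k. rewrite filter_In, in_seq. repeat split; (lia || easy).
    + intros (L' & HL & Hk). rewrite in_map_iff in Hk. destruct Hk as (k' & E & Hk).
      injection E as -> ->. rewrite in_partitions in HL. rewrite filter_In in Hk.
      destruct HL as [P Hn]. destruct Hk as [_ H].
      destruct (remove_box_spec _ _ _ P H) as (H1&H2&H3&H4).
      exists (remove_box L k, k). simpl. rewrite H3. split; [easy|]. apply M.
      repeat split; (lia || easy).
Qed.

(** [down_rate_sum] spreads the weight of each larger partition over its removable boxes; the edges
    are then enumerated from below, and detailed balance turns their weights into transition
    probabilities. *)
Lemma jack_mean_S (n : nat) (g : list nat -> R) :
  jack_mean (S n) g
  = jack_mean n (fun l => lsum (seq 0 (S (length l))) (fun k => up_prob l k * g (add_box l k))).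
Proof.
  unfold jack_mean. assert (0 < INR (S n)) by (apply lt_0_INR; lia).
  set (f := fun q : list nat * nat => jack_weight alpha (S n) (fst q)
              * (down_rate (fst q) (snd q) / (alpha * INR (S n))) * g (fst q)).
  transitivity (lsum (flat_map (fun l => map (pair l) (filter (removable l) (seq 0 (length l))))
                        (partitions (S n))) f).
  - rewrite lsum_flat_map. apply lsum_ext. intros l Hl. apply in_partitions in Hl as [P Hl].
    rewrite lsum_map, lsum_filter.
    rewrite (lsum_ext _ _ (fun k => (jack_weight alpha (S n) l * g l / (alpha * INR (S n))) * down_rate l k)).
    + rewrite lsum_scal, (down_rate_sum (S n)), Hl by easy. field. lra.
    + intros k _. unfold f. simpl fst. simpl snd. destruct (removable l k) eqn:E.
      * field. lra.
      * rewrite (down_rate_not_removable (S n) l k) by easy. ring.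
  - rewrite <- (lsum_permutation _ _ f (add_box_pairs n)), lsum_map, lsum_flat_map.
    apply lsum_ext. intros l Hl. apply in_partitions in Hl as [P Hl].
    apply (is_partition_le n (S n)) in P as P'; [|lia].
    rewrite lsum_map, lsum_filter, <- lsum_scal. apply lsum_ext. intros k Hk. apply in_seq in Hk.
    unfold f. simpl fst. simpl snd. destruct (addable (S n) l k) eqn:E.
    + rewrite <- (up_down n) by easy. ring.
    + destruct (up_prob_not_addable (S n) l k P') as [-> | [_ E']]; [lia|easy|ring|].
      pose proof (nth_le_partition n l 0 P). lia.
Qed.

Lemma jack_mean_ext (n : nat) (f g : list nat -> R) :
  (forall l, is_partition n l -> list_sum l = n -> f l = g l) -> jack_mean n f = jack_mean n g.
Proof. intros H. apply lsum_ext. intros l Hl. apply in_partitions in Hl as [P E]. now rewrite H. Qed.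

Lemma jack_mean_1 (n : nat) : jack_mean n (fun _ => 1) = 1.
Proof.
  induction n.
  - unfold jack_mean, partitions, jack_weight, lsum, hook_product. simpl. field.
  - rewrite jack_mean_S. transitivity (jack_mean n (fun _ => 1)); [|easy]. apply jack_mean_ext. intros l P E.
    rewrite (lsum_ext _ _ (up_prob l)) by (intros; ring). now apply (up_sum_0 n).
Qed.

Lemma jack_mean_plus (n : nat) (f g : list nat -> R) :
  jack_mean n (fun l => f l + g l) = jack_mean n f + jack_mean n g.
Proof. unfold jack_mean. rewrite <- lsum_plus. apply lsum_ext. intros; ring. Qed.

Lemma jack_mean_scal (n : nat) (c : R) (g : list nat -> R) :
  jack_mean n (fun l => c * g l) = c * jack_mean n g.
Proof. unfold jack_mean. rewrite <- lsum_scal. apply lsum_ext. intros; ring. Qed.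

Lemma jack_mean_minus (n : nat) (f g : list nat -> R) :
  jack_mean n (fun l => f l - g l) = jack_mean n f - jack_mean n g.
Proof. unfold jack_mean. rewrite <- lsum_minus. apply lsum_ext. intros; ring. Qed.

Lemma jack_mean_const (n : nat) (c : R) : jack_mean n (fun _ => c) = c.
Proof.
  transitivity (jack_mean n (fun _ => c * 1)); [apply jack_mean_ext; intros; ring|].
  rewrite jack_mean_scal, jack_mean_1. ring.
Qed.

Lemma jack_weight_nonneg (n m : nat) (l : list nat) : is_partition m l -> 0 <= jack_weight alpha n l.
Proof.
  intros P. unfold jack_weight. apply Rmult_le_pos.
  - apply Rmult_le_pos; [apply pow_le; lra|apply pos_INR].
  - left. apply Rinv_0_lt_compat. now apply hook_product_pos with m.
Qed.

Lemma jack_mean_le (n : nat) (f g : list nat -> R) :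
  (forall l, is_partition n l -> list_sum l = n -> f l <= g l) -> jack_mean n f <= jack_mean n g.
Proof.
  intros H. apply lsum_le. intros l Hl. apply in_partitions in Hl as [P E].
  apply Rmult_le_compat_l; [now apply jack_weight_nonneg with n|now apply H].
Qed.

Lemma jack_mean_Rabs (n : nat) (f : list nat -> R) :
  Rabs (jack_mean n f) <= jack_mean n (fun l => Rabs (f l)).
Proof.
  apply Rle_trans with (1 := lsum_Rabs _ _). right. apply lsum_ext. intros l Hl.
  apply in_partitions in Hl as [P _].
  rewrite Rabs_mult, (Rabs_pos_eq (jack_weight _ _ _)); [easy|now apply jack_weight_nonneg with n].
Qed.

Lemma jack_mean_jump (n : nat) (g : R -> R) :
  jack_mean (S n) (fun l => g (content_sum l))
  = jack_mean n (fun l => lsum (seq 0 (S (length l)))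
                   (fun k => up_prob l k * g (content_sum l + content l k))).
Proof.
  rewrite jack_mean_S. apply jack_mean_ext. intros l P E. apply lsum_ext. intros k Hk.
  apply in_seq in Hk. apply (is_partition_le n (S n)) in P as P'; [|lia].
  destruct (addable (S n) l k) eqn:A.
  - now rewrite (content_sum_add_box (S n)).
  - destruct (up_prob_not_addable (S n) l k P') as [-> | [_ E']]; [lia|easy|ring|].
    pose proof (nth_le_partition n l 0 P). lia.
Qed.

Lemma binom2_S (n : nat) : binom2 (S n) = binom2 n + INR n.
Proof. unfold binom2. rewrite S_INR. field. Qed.

Lemma content_sum_variance (n : nat) : jack_mean n (fun l => content_sum l ^ 2) = alpha * binom2 n.
Proof.
  induction n.
  - unfold jack_mean, partitions, lsum, binom2. simpl. unfold Rdiv. ring.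
  - rewrite (jack_mean_jump n (fun x => x ^ 2)), binom2_S, Rmult_plus_distr_l, <- IHn.
    rewrite <- (jack_mean_const n (alpha * INR n)), <- jack_mean_plus.
    apply jack_mean_ext. intros l P E.
    rewrite (lsum_ext _ _ (fun k => content_sum l ^ 2 * up_prob l k
       + (2 * content_sum l) * (up_prob l k * content l k) + up_prob l k * content l k ^ 2))
      by (intros; ring).
    rewrite !lsum_plus, !lsum_scal, (up_sum_0 n), (up_sum_1 n), (up_sum_2 n), E by easy. ring.
Qed.

(** Columns beyond the first row are empty, so a sum over any sufficient range of columns can
    replace the list [conjugate], which is awkward in inductions on rows. *)
Lemma conjugate_sum (m : nat) (l : list nat) (f : nat -> R) : is_partition m l -> f 0%nat = 0 ->
  lsum (seq 0 m) (fun c => f (col_len l c)) = lsum (conjugate l) f.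
Proof.
  intros P H0. unfold conjugate. rewrite lsum_map.
  assert (Hm : (hd 0 l <= m)%nat) by (destruct l; simpl in *; lia).
  replace (seq 0 m) with (seq 0 (hd 0%nat l) ++ seq (hd 0%nat l) (m - hd 0%nat l))
    by (rewrite <- seq_app; f_equal; lia).
  rewrite lsum_app, (lsum_0 (seq (hd 0%nat l) _)); [ring|].
  intros c Hc. apply in_seq in Hc. rewrite (col_len_large (hd 0%nat l)); [easy| |lia].
  destruct l; [easy|]. simpl in *. split; [lia|easy].
Qed.

Lemma conjugate_list_sum (m : nat) (l : list nat) : is_partition m l ->
  lsum (conjugate l) INR = INR (list_sum l).
Proof.
  revert m. induction l as [|r mu IH]; intros m P; [reflexivity|]. destruct P as [Hr P].
  rewrite <- (conjugate_sum r) by (simpl; easy || lia).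
  rewrite (lsum_ext _ _ (fun c => 1 + INR (col_len mu c))).
  - rewrite lsum_plus, (conjugate_sum r), (IH r) by easy. simpl list_sum. rewrite plus_INR.
    f_equal. clear. induction r; [reflexivity|]. rewrite lsum_seq_S_r, IHr, S_INR. ring.
  - intros c Hc. apply in_seq in Hc. rewrite col_len_cons.
    destruct (Nat.ltb_spec c r); [|lia]. rewrite plus_INR. reflexivity.
Qed.

Lemma content_sum_conjugate (m : nat) (l : list nat) : is_partition m l ->
  content_sum l = alpha * sumR (map binom2 l) - sumR (map binom2 (conjugate l)).
Proof.
  revert m. induction l as [|r mu IH]; intros m P; [simpl; ring|]. destruct P as [Hr P].
  fold (lsum (conjugate (r :: mu)) binom2).
  rewrite <- (conjugate_sum r) by (simpl; (easy || lia) || (unfold binom2; simpl; field)).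
  rewrite (lsum_ext _ _ (fun c => binom2 (col_len mu c) + INR (col_len mu c))).
  - rewrite lsum_plus, !(conjugate_sum r), (conjugate_list_sum r)
      by (easy || (unfold binom2; simpl; field)).
    simpl content_sum. rewrite (IH r) by easy. simpl map. unfold lsum. simpl. ring.
  - intros c Hc. apply in_seq in Hc. rewrite col_len_cons.
    destruct (Nat.ltb_spec c r); [|lia]. apply binom2_S.
Qed.

(** * Long rows and columns are rare *)

Lemma lprod_seq_S (n : nat) (f : nat -> R) :
  lprod (seq 0 (S n)) f = f 0%nat * lprod (seq 0 n) (fun k => f (S k)).
Proof. rewrite <- cons_seq, lprod_cons, <- seq_shift. unfold lprod. now rewrite map_map. Qed.

Lemma lprod_rev_square (n : nat) :
  lprod (seq 0 n) (fun c => alpha * INR (n - c) ^ 2) = alpha ^ n * INR (fact n) ^ 2.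
Proof.
  induction n; [unfold lprod; simpl; ring|].
  rewrite lprod_seq_S.
  change (alpha * INR (S n) ^ 2 * lprod (seq 0 n) (fun c => alpha * INR (n - c) ^ 2)
          = alpha ^ S n * INR (fact (S n)) ^ 2).
  rewrite IHn, fact_simpl, mult_INR, <- (tech_pow_Rmult alpha). ring.
Qed.

Lemma fact_le_pow (n l : nat) : (l <= n)%nat -> INR (fact n) <= INR n ^ l * INR (fact (n - l)).
Proof.
  induction l; intros H; [simpl; rewrite Nat.sub_0_r; lra|].
  apply Rle_trans with (1 := IHl ltac:(lia)).
  replace (n - l)%nat with (S (n - S l)) by lia.
  rewrite fact_simpl, mult_INR, <- tech_pow_Rmult.
  rewrite <- Rmult_assoc, (Rmult_comm (INR n)).
  apply Rmult_le_compat_r; [apply pos_INR|].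
  apply Rmult_le_compat_l; [apply pow_le, pos_INR|]. apply le_INR. lia.
Qed.

(** Without legs, a box of arm a still has hook at least alpha (a + 1)^2. *)
Lemma row_hook_ge (r : nat) (mu : list nat) : alpha ^ r * INR (fact r) ^ 2 <= row_hook r mu.
Proof.
  rewrite <- lprod_rev_square. apply lprod_le. intros c Hc. apply in_seq in Hc.
  replace (r - c)%nat with (S (r - 1 - c)) by lia. rewrite S_INR. unfold hook.
  pose proof (pos_INR (r - 1 - c)). pose proof (pos_INR (col_len mu c)).
  split; [apply Rmult_le_pos; nra|].
  replace (alpha * (INR (r - 1 - c) + 1) ^ 2) with ((INR (r - 1 - c) + 1) * (alpha * (INR (r - 1 - c) + 1))) by ring.
  apply Rmult_le_compat; nra.
Qed.

Lemma jack_weight_le (n l m m' : nat) (lam mu : list nat) (c : R) :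
  (l <= n)%nat -> is_partition m lam -> is_partition m' mu -> 0 < c ->
  hook_product alpha mu * c <= hook_product alpha lam ->
  jack_weight alpha n lam <= jack_weight alpha (n - l) mu * ((alpha * INR n) ^ l / c).
Proof.
  intros Hl P P' Hc H. unfold jack_weight.
  pose proof (hook_product_pos _ _ P). pose proof (hook_product_pos _ _ P').
  apply Rle_trans with (alpha ^ n * (INR n ^ l * INR (fact (n - l))) / (hook_product alpha mu * c)).
  - apply Rmult_le_compat.
    + apply Rmult_le_pos; [apply pow_le; lra|apply pos_INR].
    + left. now apply Rinv_0_lt_compat.
    + apply Rmult_le_compat_l; [apply pow_le; lra|now apply fact_le_pow].
    + apply Rinv_le_contravar; [now apply Rmult_lt_0_compat|easy].
  - right. replace n with ((n - l) + l)%nat at 1 by lia.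
    rewrite pow_add, Rpow_mult_distr. field. lra.
Qed.

Lemma jack_weight_first_row (n r : nat) (mu : list nat) :
  is_partition n (r :: mu) -> list_sum (r :: mu) = n ->
  jack_weight alpha n (r :: mu)
    <= jack_weight alpha (n - r) mu * ((alpha * INR n) ^ r / INR (fact r) ^ 2).
Proof.
  intros P E. assert (P' := P). destruct P' as [Hr P']. pose proof (INR_fact_lt_0 r).
  apply jack_weight_le with n r; [lia|easy|easy|now apply pow_lt|].
  rewrite hook_product_cons by easy. pose proof (row_hook_ge r mu). pose proof (hook_product_pos _ _ P').
  (* The power of alpha is given away so that rows obey the same bound as columns. *)
  assert (1 <= alpha ^ r) by now apply pow_R1_Rle.
  rewrite Rmult_comm. apply Rmult_le_compat_r; nra.
Qed.

(* The partition with its first column removed. *)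
Fixpoint strip (l : list nat) : list nat :=
  match l with
  | S (S r) :: mu => S r :: strip mu
  | _ => []
  end.

Lemma strip_ones (mu : list nat) : is_partition 1 mu -> strip mu = [] /\ list_sum mu = length mu.
Proof.
  induction mu as [|r mu IH]; [easy|]. intros [Hr P]. assert (r = 1)%nat as -> by lia.
  split; [easy|]. simpl. now rewrite (proj2 (IH P)).
Qed.

Lemma strip_spec (m : nat) (l : list nat) : is_partition (S m) l ->
  is_partition m (strip l) /\ list_sum l = (list_sum (strip l) + length l)%nat /\
  (forall c, col_len (strip l) c = col_len l (S c)) /\ col_len l 0 = length l.
Proof.
  revert m. induction l as [|r mu IH]; intros m P; [easy|]. destruct P as [Hr P].
  destruct r as [|[|r]]; [lia| |].
  - destruct (IH 0%nat P) as (H1 & H2 & H3 & H4). destruct (strip_ones mu P) as [E1 E2].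
    repeat split; simpl; try lia.
    + intros c. rewrite col_len_cons, (col_len_large 1 mu) by (easy || lia). easy.
    + rewrite col_len_cons, H4. easy.
  - destruct (IH (S r) P) as (H1 & H2 & H3 & H4).
    repeat split; simpl; try easy; try lia.
    + intros c. now rewrite !col_len_cons, H3.
    + rewrite col_len_cons, H4. easy.
Qed.

Lemma strip_inj (m : nat) (l l' : list nat) :
  is_partition m l -> is_partition m l' -> length l = length l' -> strip l = strip l' -> l = l'.
Proof.
  revert m l'. induction l as [|r mu IH]; intros m [|r' mu'] P P' L E; try easy.
  destruct P as [Hr P], P' as [Hr' P']. injection L as L.
  destruct r as [|[|r]], r' as [|[|r']]; try lia; try discriminate.
  - f_equal. apply (IH 1%nat); try easy. now rewrite (proj1 (strip_ones mu P)), (proj1 (strip_ones mu' P')).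
  - injection E as -> E. f_equal. now apply (IH (S (S r'))).
Qed.

(** Stripping removes the hooks of the first column and preserves the others. A first-column box of
    leg l has hook at least (l + 1)^2, and these legs run through 0, ..., length - 1. *)
Lemma hook_product_strip (m : nat) (l : list nat) : is_partition m l ->
  hook_product alpha (strip l) * INR (fact (length l)) ^ 2 <= hook_product alpha l.
Proof.
  revert m. induction l as [|r mu IH]; intros m P; [unfold hook_product; simpl; lra|].
  destruct P as [Hr P]. rewrite (hook_product_cons r mu P).
  specialize (IH r P). destruct r as [|r]; [lia|].
  destruct (strip_spec r mu P) as (P' & _ & HC & HC0).
  assert (B : INR (S (length mu)) ^ 2 * row_hook r (strip mu) <= row_hook (S r) mu).
  { unfold row_hook. rewrite lprod_seq_S, HC0.
    rewrite (lprod_ext (seq 0 r) (fun c => hook (r - 1 - c) (col_len (strip mu) c))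
      (fun k => hook (S r - 1 - S k) (col_len mu (S k)))).
    2:{ intros c Hc. apply in_seq in Hc. rewrite HC. f_equal. lia. }
    apply Rmult_le_compat_r.
    - left. apply lprod_pos. intros; apply hook_pos.
    - unfold hook. rewrite (S_INR (length mu)).
      pose proof (pos_INR (S r - 1 - 0)). pose proof (pos_INR (length mu)).
      rewrite <- Rsqr_pow2. apply Rmult_le_compat; nra. }
  assert (F : INR (fact (length (S r :: mu))) ^ 2 = INR (S (length mu)) ^ 2 * INR (fact (length mu)) ^ 2).
  { simpl length. rewrite fact_simpl, mult_INR. ring. }
  assert (E : hook_product alpha (strip (S r :: mu)) = row_hook r (strip mu) * hook_product alpha (strip mu)).
  { destruct r.
    - rewrite (proj1 (strip_ones mu P)). unfold hook_product, row_hook, lprod. simpl. ring.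
    - change (strip (S (S r) :: mu)) with (S r :: strip mu). now apply hook_product_cons. }
  rewrite E, F. pose proof (hook_product_pos _ _ P'). pose proof (row_hook_pos r (strip mu)).
  pose proof (pow2_ge_0 (INR (S (length mu)))). pose proof (pow2_ge_0 (INR (fact (length mu)))).
  replace (row_hook r (strip mu) * hook_product alpha (strip mu) *
           (INR (S (length mu)) ^ 2 * INR (fact (length mu)) ^ 2))
    with ((INR (S (length mu)) ^ 2 * row_hook r (strip mu)) *
          (hook_product alpha (strip mu) * INR (fact (length mu)) ^ 2)) by ring.
  apply Rmult_le_compat; try easy; apply Rmult_le_pos; lra.
Qed.

Definition ind (b : bool) : R := if b then 1 else 0.

Lemma ind_bounds (b : bool) : 0 <= ind b <= 1.
Proof. destruct b; simpl; lra. Qed.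

(** The map [h] embeds the event into the partitions of n - l, whose weights have total mass 1. *)
Lemma jack_mean_ind_le (n l : nat) (b : list nat -> bool) (h : list nat -> list nat) (c : R) :
  0 <= c ->
  (forall lam, In lam (partitions n) -> b lam = true ->
     In (h lam) (partitions (n - l)) /\
     jack_weight alpha n lam <= jack_weight alpha (n - l) (h lam) * c) ->
  (forall lam lam', In lam (partitions n) -> In lam' (partitions n) ->
     b lam = true -> b lam' = true -> h lam = h lam' -> lam = lam') ->
  jack_mean n (fun lam => ind (b lam)) <= c.
Proof.
  intros Hc H Hinj. unfold jack_mean.
  rewrite (lsum_ext _ _ (fun lam => if b lam then jack_weight alpha n lam else 0))
    by (intros lam _; unfold ind; destruct (b lam); ring).
  rewrite <- lsum_filter.
  apply Rle_trans with (lsum (filter b (partitions n)) (fun lam => c * jack_weight alpha (n - l) (h lam))).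
  { apply lsum_le. intros lam Hl. apply filter_In in Hl as [Hl B]. rewrite Rmult_comm. now apply H. }
  rewrite lsum_scal, <- (lsum_map h). rewrite <- (Rmult_1_r c) at 2. apply Rmult_le_compat_l; [easy|].
  rewrite <- (jack_mean_1 (n - l)). unfold jack_mean.
  rewrite (lsum_ext (partitions (n - l)) _ (jack_weight alpha (n - l))) by (intros; ring).
  apply lsum_incl_le.
  - apply NoDup_map_NoDup_ForallPairs; [|apply NoDup_filter, NoDup_parts].
    intros lam lam' Hl Hl'. apply filter_In in Hl, Hl'. now apply Hinj.
  - intros mu Hmu. apply in_map_iff in Hmu as (lam & <- & Hl). apply filter_In in Hl. now apply H.
  - intros mu Hmu. apply in_partitions in Hmu as [P _]. now apply jack_weight_nonneg with (n - l)%nat.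
Qed.

Lemma first_row_law (n l : nat) : (1 <= l <= n)%nat ->
  jack_mean n (fun lam => ind (Nat.eqb (hd 0%nat lam) l)) <= (alpha * INR n) ^ l / INR (fact l) ^ 2.
Proof.
  intros Hl. apply (jack_mean_ind_le n l _ (@tl nat)).
  - pose proof (INR_fact_lt_0 l). pose proof (pos_INR n).
    apply Rmult_le_pos; [apply pow_le; nra|]. left. apply Rinv_0_lt_compat. now apply pow_lt.
  - intros [|r mu] Hlam E; apply Nat.eqb_eq in E; simpl in E; [lia|]. subst r.
    apply in_partitions in Hlam as [P E]. split; [|now apply jack_weight_first_row].
    simpl tl. apply in_partitions. simpl in P, E. split; [|lia].
    destruct mu as [|s nu]; [easy|]. simpl in *. split; [lia|easy].
  - intros [|r mu] [|r' mu'] _ _ E E'; apply Nat.eqb_eq in E, E'; simpl in *; try lia.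
    intros ->. congruence.
Qed.

Lemma length_law (n l : nat) : (1 <= l <= n)%nat ->
  jack_mean n (fun lam => ind (Nat.eqb (length lam) l)) <= (alpha * INR n) ^ l / INR (fact l) ^ 2.
Proof.
  intros Hl. pose proof (INR_fact_lt_0 l). apply (jack_mean_ind_le n l _ strip).
  - pose proof (pos_INR n).
    apply Rmult_le_pos; [apply pow_le; nra|]. left. apply Rinv_0_lt_compat. now apply pow_lt.
  - intros lam Hlam E. apply Nat.eqb_eq in E. subst l. apply in_partitions in Hlam as [P E].
    destruct n as [|n]; [lia|]. destruct (strip_spec n lam P) as (P' & E' & _).
    split.
    + apply in_partitions. split; [|lia].
      replace (S n - length lam)%nat with (list_sum (strip lam)) by lia.
      destruct (strip lam) as [|r mu]; [easy|]. simpl in *. split; [lia|easy].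
    + apply jack_weight_le with (S n) n; [lia|easy|easy|now apply pow_lt|]. now apply hook_product_strip with (S n).
  - intros lam lam' H1 H2 E E'. apply Nat.eqb_eq in E, E'. apply in_partitions in H1, H2.
    apply (strip_inj n); [easy|easy|congruence].
Qed.

Lemma pow_div_fact_le_exp (x : R) (l : nat) : 0 <= x -> x ^ l / INR (fact l) <= exp x.
Proof.
  intros Hx. apply Rle_trans with (2 := exp_ge_taylor x l Hx).
  destruct l; [simpl; lra|]. rewrite tech5.
  assert (0 <= sum_f_R0 (fun k => x ^ k / INR (fact k)) l).
  { apply cond_pos_sum. intros k. apply Rmult_le_pos; [now apply pow_le|].
    left. apply Rinv_0_lt_compat, INR_fact_lt_0. }
  lra.
Qed.

Lemma exp_INR (l : nat) : exp (INR l) = exp 1 ^ l.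
Proof. induction l; [apply exp_0|]. rewrite S_INR, exp_plus, IHl. simpl. ring. Qed.

(** From (9 y)^l / l! <= exp (9 y) <= e^l <= 3^l follows y^l / l! <= 3^(-l), whose square is at most
    e^(-l). The 9 of all later thresholds comes from here. *)
Lemma poisson_square_tail (y : R) (l : nat) : 0 <= y -> 9 * y <= INR l ->
  (y ^ 2) ^ l / INR (fact l) ^ 2 <= exp (- INR l).
Proof.
  intros Hy Hl. pose proof (INR_fact_lt_0 l).
  assert (E : y ^ l / INR (fact l) <= (/ 3) ^ l).
  { assert (Q : (9 * y) ^ l / INR (fact l) <= exp 1 ^ l).
    { rewrite <- exp_INR. apply Rle_trans with (1 := pow_div_fact_le_exp (9 * y) l ltac:(lra)).
      now apply exp_le_mono. }
    assert (Q2 : exp 1 ^ l <= 3 ^ l) by (apply pow_incr; pose proof (exp_pos 1); pose proof exp_le_3; lra).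
    rewrite Rpow_mult_distr in Q.
    assert (0 < 9 ^ l) by (apply pow_lt; lra).
    apply (Rmult_le_reg_l (9 ^ l)); [easy|]. rewrite <- Rpow_mult_distr.
    replace (9 * / 3) with 3 by field. unfold Rdiv in *. lra. }
  assert (0 <= y ^ l / INR (fact l)).
  { apply Rmult_le_pos; [now apply pow_le|]. left. now apply Rinv_0_lt_compat. }
  replace ((y ^ 2) ^ l / INR (fact l) ^ 2) with ((y ^ l / INR (fact l)) ^ 2)
    by (rewrite <- !pow_mult, Nat.mul_comm, pow_mult; field; lra).
  apply Rle_trans with (((/ 3) ^ l) ^ 2); [apply pow_incr; lra|].
  rewrite exp_Ropp, exp_INR, <- pow_inv.
  assert ((/ 3) ^ l <= / exp 1 ^ l).
  { rewrite <- pow_inv. apply pow_incr. split; [lra|]. apply Rinv_le_contravar; [apply exp_pos|apply exp_le_3]. }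
  assert (0 < (/ 3) ^ l <= 1).
  { split; [apply pow_lt; lra|]. rewrite <- (pow1 l). apply pow_incr. lra. }
  rewrite <- pow_inv in *. nra.
Qed.

Lemma pow_le_exp (k : nat) : exists c, 0 < c /\ forall x, 0 <= x -> x ^ k <= c * exp x.
Proof.
  exists (INR (fact k)). split; [apply INR_fact_lt_0|]. intros x Hx.
  pose proof (pow_div_fact_le_exp x k Hx) as H. pose proof (INR_fact_lt_0 k).
  apply (Rmult_le_reg_r (/ INR (fact k))); [now apply Rinv_0_lt_compat|].
  replace (INR (fact k) * exp x * / INR (fact k)) with (exp x) by (field; lra). exact H.
Qed.

(** [s] stands for the first row or the number of rows. The tenth power of sqrt n is n^5, of which
    one factor n pays for summing over all values l. *)
Lemma law_tail (c : R) (n : nat) (s : list nat -> nat) :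
  0 < c -> (forall x, 0 <= x -> x ^ 10 <= c * exp x) -> (1 <= n)%nat ->
  (forall lam, is_partition n lam -> list_sum lam = n -> (s lam <= n)%nat) ->
  (forall l, (1 <= l <= n)%nat ->
     jack_mean n (fun lam => ind (Nat.eqb (s lam) l)) <= (alpha * INR n) ^ l / INR (fact l) ^ 2) ->
  jack_mean n (fun lam => ind (if Rle_dec (9 * sqrt (alpha * INR n)) (INR (s lam)) then true else false))
    <= c / INR n ^ 4.
Proof.
  intros Hc Hexp Hn Hs Hlaw. assert (N1 : 1 <= INR n) by (apply (le_INR 1); lia).
  set (y := sqrt (alpha * INR n)).
  assert (Hy2 : y ^ 2 = alpha * INR n) by (apply pow2_sqrt; nra).
  assert (Hy : sqrt (INR n) <= y) by (apply sqrt_le_1_alt; nra).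
  assert (Hsn : 1 <= sqrt (INR n)) by (rewrite <- sqrt_1 at 1; now apply sqrt_le_1_alt).
  apply Rle_trans with (jack_mean n (fun lam => lsum (seq 1 n) (fun l =>
     ind (if Rle_dec (9 * y) (INR l) then true else false) * ind (Nat.eqb (s lam) l)))).
  { apply jack_mean_le. intros lam P E.
    destruct (Rle_dec (9 * y) (INR (s lam))) as [H|H].
    - assert (1 <= s lam)%nat by (apply INR_le; simpl; lra).
      assert (Hin : In (s lam) (seq 1 n)) by (apply in_seq; specialize (Hs lam P E); lia).
      destruct (in_split _ _ Hin) as (l1 & l2 & ->).
      rewrite lsum_app, lsum_cons, Nat.eqb_refl. destruct (Rle_dec (9 * y) (INR (s lam))); [|easy].
      assert (forall l, 0 <= lsum l (fun l => ind (if Rle_dec (9 * y) (INR l) then true else false)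
                  * ind (Nat.eqb (s lam) l))).
      { intros l. apply lsum_nonneg. intros k _. apply Rmult_le_pos; apply ind_bounds. }
      pose proof (H1 l1). pose proof (H1 l2). simpl (ind true) at 1 2 3. lra.
    - apply lsum_nonneg. intros k _. apply Rmult_le_pos; apply ind_bounds. }
  unfold jack_mean.
  rewrite (lsum_ext _ _ (fun lam => lsum (seq 1 n) (fun l => jack_weight alpha n lam *
      (ind (if Rle_dec (9 * y) (INR l) then true else false) * ind (Nat.eqb (s lam) l)))))
    by (intros; now rewrite lsum_scal).
  rewrite lsum_swap.
  apply Rle_trans with (lsum (seq 1 n) (fun _ => exp (- sqrt (INR n)))).
  { apply lsum_le. intros l Hl. apply in_seq in Hl.
    change (jack_mean n (fun lam => ind (if Rle_dec (9 * y) (INR l) then true else false)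
                                    * ind (Nat.eqb (s lam) l)) <= exp (- sqrt (INR n))).
    rewrite jack_mean_scal. destruct (Rle_dec (9 * y) (INR l)) as [H|H]; simpl.
    - rewrite Rmult_1_l. apply Rle_trans with (1 := Hlaw l ltac:(lia)). rewrite <- Hy2.
      apply Rle_trans with (1 := poisson_square_tail y l ltac:(lra) H).
      apply exp_le_mono. lra.
    - rewrite Rmult_0_l. left. apply exp_pos. }
  assert (E : forall (m k : nat) (x : R), lsum (seq k m) (fun _ => x) = INR m * x).
  { induction m; intros k x; [unfold lsum; simpl; ring|]. simpl seq. rewrite lsum_cons, IHm, S_INR. ring. }
  rewrite E, exp_Ropp.
  pose proof (Hexp (sqrt (INR n)) ltac:(lra)) as X.
  assert (S10 : sqrt (INR n) ^ 10 = INR n ^ 5).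
  { replace (sqrt (INR n) ^ 10) with ((sqrt (INR n) ^ 2) ^ 5) by ring. now rewrite pow2_sqrt by lra. }
  rewrite S10 in X.
  assert (0 < INR n ^ 5) by (apply pow_lt; lra).
  assert (/ exp (sqrt (INR n)) <= / (INR n ^ 5 / c)).
  { apply Rinv_le_contravar; [now apply Rdiv_lt_0_compat|].
    apply (Rmult_le_reg_l c); [easy|]. replace (c * (INR n ^ 5 / c)) with (INR n ^ 5) by (field; lra). easy. }
  replace (c / INR n ^ 4) with (INR n * / (INR n ^ 5 / c)) by (field; lra).
  apply Rmult_le_compat_l; lra.
Qed.

Definition spread (lam : list nat) : R := Rmax (INR (hd 0%nat lam)) (INR (length lam)).

Lemma hd_le_sum (lam : list nat) : (hd 0 lam <= list_sum lam)%nat.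
Proof. destruct lam; simpl; lia. Qed.

Lemma length_le_sum (m : nat) (lam : list nat) : is_partition m lam -> (length lam <= list_sum lam)%nat.
Proof.
  revert m. induction lam as [|r mu IH]; intros m P; [easy|]. destruct P as [Hr P].
  specialize (IH r P). simpl. lia.
Qed.

Definition wide (n : nat) (lam : list nat) : R :=
  if Rle_dec (9 * sqrt (alpha * INR n)) (spread lam) then 1 else 0.

(** The fourth power is what offsets the factor k^4 that [jump_vs_heat_crude] costs on wide
    partitions. *)
Lemma wide_rare : exists c, 0 < c /\ forall n, (1 <= n)%nat -> jack_mean n (wide n) <= c / INR n ^ 4.
Proof.
  destruct (pow_le_exp 10) as (c & Hc & Hexp). exists (2 * c). split; [lra|]. intros n Hn.
  pose proof (law_tail c n (hd 0%nat) Hc Hexp Hn (fun lam _ E => eq_ind _ (fun m => (hd 0 lam <= m)%nat) (hd_le_sum lam) _ E)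
                (first_row_law n)) as T1.
  pose proof (law_tail c n (@length nat) Hc Hexp Hn
    (fun lam P E => eq_ind _ (fun m => (length lam <= m)%nat) (length_le_sum n lam P) _ E) (length_law n)) as T2.
  apply Rle_trans with (jack_mean n (fun lam =>
    ind (if Rle_dec (9 * sqrt (alpha * INR n)) (INR (hd 0%nat lam)) then true else false) +
    ind (if Rle_dec (9 * sqrt (alpha * INR n)) (INR (length lam)) then true else false))).
  - apply jack_mean_le. intros lam _ _. unfold wide, spread.
    destruct (Rle_dec _ (Rmax _ _)) as [H|H].
    + apply Rmax_Rle in H.
      destruct (Rle_dec _ (INR (hd 0%nat lam))), (Rle_dec _ (INR (length lam))); simpl; try lra; tauto.
    + pose proof (ind_bounds (if Rle_dec (9 * sqrt (alpha * INR n)) (INR (hd 0%nat lam)) then true else false)).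
      pose proof (ind_bounds (if Rle_dec (9 * sqrt (alpha * INR n)) (INR (length lam)) then true else false)).
      lra.
  - rewrite jack_mean_plus.
    replace (2 * c / INR n ^ 4) with (c / INR n ^ 4 + c / INR n ^ 4) by (unfold Rdiv; ring). lra.
Qed.

Lemma content_spread (m : nat) (lam : list nat) (k : nat) :
  is_partition m lam -> (k <= length lam)%nat -> Rabs (content lam k) <= alpha * spread lam.
Proof.
  intros P Hk. assert (P' : is_partition (hd 0%nat lam) lam).
  { destruct lam; [easy|]. simpl in *. split; [lia|easy]. }
  pose proof (content_le _ lam k P'). unfold spread.
  pose proof (Rmax_l (INR (hd 0%nat lam)) (INR (length lam))).
  pose proof (Rmax_r (INR (hd 0%nat lam)) (INR (length lam))).
  apply le_INR in Hk. pose proof (pos_INR (hd 0%nat lam)). pose proof (pos_INR k).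
  pose proof (pos_INR (nth k lam 0%nat)).
  apply Rabs_le. split; [|nra]. unfold content. nra.
Qed.

(** * Induction on the size *)

(** Distribution function of the content sum plus an independent centred Gaussian of standard
    deviation t. *)
Definition smooth_cdf (n : nat) (t y : R) : R :=
  jack_mean n (fun lam => Phi ((y - content_sum lam) / t)).

(** The same with the content sum replaced by a Gaussian of its own variance. *)
Definition limit_cdf (n : nat) (t y : R) : R := Phi (y / sqrt (alpha * binom2 n + t ^ 2)).

Lemma binom2_nonneg (n : nat) : 0 <= binom2 n.
Proof.
  unfold binom2. destruct n; [simpl; lra|]. rewrite S_INR. pose proof (pos_INR n). nra.
Qed.

(** Concentration at scale t follows from normal approximation at smoothing 2 t: the envelope is a
    Gaussian profile of standard deviation 2, and [env_le_Phi_diff] turns its mean into an increment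
    of the smoothed distribution function. *)
Lemma env_mean_le (n : nat) (t y D : R) : 0 < t ->
  (forall x, Rabs (smooth_cdf n (2 * t) x - limit_cdf n (2 * t) x) <= D) ->
  jack_mean n (fun lam => env ((y - content_sum lam) / t))
    <= env_const * (4 * t / sqrt (alpha * binom2 n + (2 * t) ^ 2) + 2 * D).
Proof.
  intros Ht HD. pose proof env_const_pos.
  apply Rle_trans with (env_const * (smooth_cdf n (2 * t) (y + 2 * t) - smooth_cdf n (2 * t) (y - 2 * t))).
  - unfold smooth_cdf. rewrite <- jack_mean_minus, <- jack_mean_scal. apply jack_mean_le. intros lam _ _.
    apply Rle_trans with (1 := env_le_Phi_diff _). right. f_equal. f_equal; f_equal; field; lra.
  - apply Rmult_le_compat_l; [lra|].
    pose proof (HD (y + 2 * t)) as H1. pose proof (HD (y - 2 * t)) as H2.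
    apply Rabs_le_between in H1. apply Rabs_le_between in H2.
    unfold limit_cdf in *. set (q := sqrt _) in *.
    assert (Hq : 0 < q).
    { apply sqrt_lt_R0. pose proof (binom2_nonneg n). nra. }
    assert ((y - 2 * t) / q <= (y + 2 * t) / q).
    { apply Rmult_le_compat_r; [left; now apply Rinv_0_lt_compat|lra]. }
    pose proof (Phi_lipschitz _ _ H0) as L.
    replace ((y + 2 * t) / q - (y - 2 * t) / q) with (4 * t / q) in L by (field; lra). lra.
Qed.

Lemma content_sum_abs_mean (n : nat) : jack_mean n (fun lam => Rabs (content_sum lam)) <= alpha * INR n.
Proof.
  destruct n.
  - unfold jack_mean, partitions, lsum. simpl. rewrite Rabs_R0. lra.
  - assert (N1 : 1 <= INR (S n)) by (apply (le_INR 1); lia). set (N := INR (S n)) in *.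
    (* AM-GM: [2 |s| <= s^2 / N + N] *)
    apply Rle_trans with (jack_mean (S n) (fun lam => / (2 * N) * content_sum lam ^ 2 + N / 2)).
    + apply jack_mean_le. intros lam _ _. rewrite <- (pow2_abs (content_sum lam)).
      set (s := Rabs _). apply (Rmult_le_reg_l (2 * N)); [lra|].
      replace (2 * N * (/ (2 * N) * s ^ 2 + N / 2)) with (s ^ 2 + N ^ 2) by (field; lra).
      pose proof (pow2_ge_0 (s - N)). nra.
    + rewrite jack_mean_plus, jack_mean_scal, content_sum_variance, jack_mean_const.
      unfold binom2. fold N.
      replace (/ (2 * N) * (alpha * (N * (N - 1) / 2)) + N / 2) with (alpha * (N - 1) / 4 + N / 2)
        by (field; lra). nra.
Qed.

(** The three errors come from the third moment, from the fourth order terms on ordinary partitions,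
    and from the wide partitions, where k^4 / v^2 meets a probability of order k^(-4). *)
Lemma jump_step : exists C, 0 < C /\ forall (k : nat) (v y : R),
  1 <= v -> 81 * alpha ^ 3 * INR k <= v ->
  Rabs (jack_mean (S k) (fun lam => Phi ((y - content_sum lam) / sqrt v))
        - jack_mean k (fun lam => Phi ((y - content_sum lam) / sqrt (v + alpha * INR k))))
  <= C * (INR k / (v * sqrt v)
          + INR k ^ 2 / v ^ 2 * jack_mean k (fun lam => env ((y - content_sum lam) / sqrt v))
          + / v ^ 2).
Proof.
  destruct wide_rare as (c & Hc & Hw).
  set (a3 := 3 * alpha ^ 2). set (a4 := 96 * (6561 * alpha ^ 6 + alpha ^ 2)). set (a5 := 64 * alpha ^ 4 * c).
  assert (A2 : 1 <= alpha ^ 2) by now apply pow_R1_Rle.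
  assert (A3 : 1 <= alpha ^ 3) by now apply pow_R1_Rle.
  assert (A4 : 1 <= alpha ^ 4) by now apply pow_R1_Rle.
  assert (A6 : 1 <= alpha ^ 6) by now apply pow_R1_Rle.
  assert (B3 : 0 < a3) by (unfold a3; lra). assert (B4 : 0 < a4) by (unfold a4; lra).
  assert (B5 : 0 < a5) by (unfold a5; nra).
  exists (a3 + a4 + a5). split; [lra|]. intros k v y Hv1 Hv.
  assert (Hv0 : 0 < v) by lra. pose proof (sqrt_lt_R0 v Hv0) as Hs. pose proof (pos_INR k) as Hk.
  set (Kk := INR k) in *.
  assert (V2 : 0 < v ^ 2) by now apply pow_lt.
  assert (iV2 : 0 < / v ^ 2) by now apply Rinv_0_lt_compat.
  rewrite (jack_mean_jump k (fun s => Phi ((y - s) / sqrt v))), <- jack_mean_minus.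
  apply Rle_trans with (1 := jack_mean_Rabs _ _).
  assert (alpha <= alpha ^ 3) by (replace (alpha ^ 3) with (alpha * alpha ^ 2) by ring; nra).
  assert (Hd : alpha * Kk <= v) by nra.
  (* Bounds the contents of a partition that is not wide; the hypothesis on v says exactly b^2 <=
     v. *)
  set (b := 9 * alpha * sqrt (alpha * Kk)).
  assert (Hb0 : 0 <= b) by (unfold b; pose proof (sqrt_pos (alpha * Kk)); nra).
  assert (Hb2 : b ^ 2 = 81 * alpha ^ 3 * Kk).
  { unfold b. replace ((9 * alpha * sqrt (alpha * Kk)) ^ 2) with (81 * alpha ^ 2 * sqrt (alpha * Kk) ^ 2) by ring.
    rewrite pow2_sqrt by nra. ring. }
  assert (Hbv : b <= sqrt v).
  { rewrite <- (sqrt_pow2 b) by easy. apply sqrt_le_1_alt. lra. }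
  assert (Hb4 : 96 * (b ^ 4 + (alpha * Kk) ^ 2) = a4 * Kk ^ 2).
  { replace (b ^ 4) with ((b ^ 2) ^ 2) by ring. rewrite Hb2. unfold a4. ring. }
  apply Rle_trans with (jack_mean k (fun lam =>
     (2 * alpha / sqrt v ^ 3) * Rabs (content_sum lam) + alpha * (alpha - 1) * Kk / sqrt v ^ 3
     + (a4 * Kk ^ 2 / v ^ 2) * env ((y - content_sum lam) / sqrt v)
     + (64 * alpha ^ 4 * Kk ^ 4 / v ^ 2) * wide k lam)).
  - apply jack_mean_le. intros lam P E.
    set (w := y - content_sum lam).
    rewrite (lsum_ext _ (fun j => up_prob lam j * Phi ((y - (content_sum lam + content lam j)) / sqrt v))
       (fun j => up_prob lam j * Phi ((w - content lam j) / sqrt v)))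
      by (intros; unfold w; do 3 f_equal; ring).
    pose proof (up_sum_0 k lam P) as S0. pose proof (up_sum_1 k lam P) as S1.
    pose proof (up_sum_2 k lam P) as S2. pose proof (up_sum_3 k lam P) as S3.
    rewrite E in S2, S3. fold Kk in S2, S3.
    set (m := 2 * alpha * content_sum lam + alpha * (alpha - 1) * Kk) in *.
    assert (Hm : Rabs m / sqrt v ^ 3
              <= (2 * alpha / sqrt v ^ 3) * Rabs (content_sum lam) + alpha * (alpha - 1) * Kk / sqrt v ^ 3).
    { assert (0 < sqrt v ^ 3) by now apply pow_lt.
      replace ((2 * alpha / sqrt v ^ 3) * Rabs (content_sum lam) + alpha * (alpha - 1) * Kk / sqrt v ^ 3)
        with ((2 * alpha * Rabs (content_sum lam) + alpha * (alpha - 1) * Kk) / sqrt v ^ 3) by (field; lra).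
      apply Rmult_le_compat_r; [left; now apply Rinv_0_lt_compat|].
      unfold m. apply Rle_trans with (1 := Rabs_triang _ _). rewrite Rabs_mult.
      rewrite (Rabs_pos_eq (2 * alpha)) by lra. rewrite (Rabs_pos_eq (alpha * (alpha - 1) * Kk)); [lra|].
      apply Rmult_le_pos; nra. }
    pose proof (env_pos (w / sqrt v)) as He.
    assert (T4 : 0 <= (a4 * Kk ^ 2 / v ^ 2) * env (w / sqrt v)).
    { apply Rmult_le_pos; [|lra]. apply Rmult_le_pos; [|lra]. apply Rmult_le_pos; [lra|apply pow2_ge_0]. }
    assert (Hcont : forall j, In j (seq 0 (S (length lam))) -> Rabs (content lam j) <= alpha * spread lam).
    { intros j Hj. apply in_seq in Hj. now apply (content_spread k); [|lia]. }
    unfold wide. fold Kk. destruct (Rle_dec (9 * sqrt (alpha * Kk)) (spread lam)) as [W|W].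
    + assert (Hsp : spread lam <= Kk).
      { unfold spread, Kk. rewrite <- E. apply Rmax_lub; apply le_INR; [apply hd_le_sum|].
        now apply (length_le_sum k). }
      pose proof (jump_vs_heat_crude _ (up_prob lam) (content lam) w v (alpha * Kk) m (alpha * Kk)
        (fun j _ => up_prob_nonneg k lam j P) S0 S1 S2 S3) as J.
      specialize (J ltac:(intros j Hj; specialize (Hcont j Hj); nra) Hv0 ltac:(nra)).
      apply Rle_trans with (1 := J).
      assert (Kk ^ 2 <= Kk ^ 4).
      { unfold Kk. rewrite <- !pow_INR. apply le_INR. destruct k; [easy|]. apply Nat.pow_le_mono_r; lia. }
      assert (32 * ((alpha * Kk) ^ 4 + (alpha * Kk) ^ 2) / v ^ 2 <= 64 * alpha ^ 4 * Kk ^ 4 / v ^ 2 * 1).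
      { rewrite Rmult_1_r. apply Rmult_le_compat_r; [lra|]. rewrite !Rpow_mult_distr.
        assert (alpha ^ 2 <= alpha ^ 4) by (replace (alpha ^ 4) with (alpha ^ 2 * alpha ^ 2) by ring; nra).
        pose proof (pow2_ge_0 Kk). nra. }
      lra.
    + pose proof (jump_vs_heat_env _ (up_prob lam) (content lam) w v (alpha * Kk) m b
        (fun j _ => up_prob_nonneg k lam j P) S0 S1 S2 S3) as J.
      specialize (J ltac:(intros j Hj; specialize (Hcont j Hj); unfold b; nra) Hv0 ltac:(nra) Hbv Hd).
      apply Rle_trans with (1 := J).
      replace (96 * env (w / sqrt v) * (b ^ 4 + (alpha * Kk) ^ 2) / v ^ 2)
        with (96 * (b ^ 4 + (alpha * Kk) ^ 2) / v ^ 2 * env (w / sqrt v)) by (field; lra).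
      rewrite Hb4. lra.
  - rewrite !jack_mean_plus, !jack_mean_scal, jack_mean_const.
    assert (Hs3 : sqrt v ^ 3 = v * sqrt v) by now apply sqrt_pow3.
    rewrite Hs3. assert (0 < v * sqrt v) by nra.
    pose proof (content_sum_abs_mean k) as M1. fold Kk in M1.
    assert (P1 : 2 * alpha / (v * sqrt v) * jack_mean k (fun lam => Rabs (content_sum lam))
            + alpha * (alpha - 1) * Kk / (v * sqrt v) <= a3 * (Kk / (v * sqrt v))).
    { replace (2 * alpha / (v * sqrt v) * jack_mean k (fun lam => Rabs (content_sum lam))
            + alpha * (alpha - 1) * Kk / (v * sqrt v))
        with ((2 * alpha * jack_mean k (fun lam => Rabs (content_sum lam)) + alpha * (alpha - 1) * Kk)
               / (v * sqrt v)) by (field; lra).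
      replace (a3 * (Kk / (v * sqrt v))) with (a3 * Kk / (v * sqrt v)) by (field; lra).
      apply Rmult_le_compat_r; [left; now apply Rinv_0_lt_compat|]. unfold a3. nra. }
    assert (P3 : 64 * alpha ^ 4 * Kk ^ 4 / v ^ 2 * jack_mean k (wide k) <= a5 * / v ^ 2).
    { replace (64 * alpha ^ 4 * Kk ^ 4 / v ^ 2 * jack_mean k (wide k))
        with (64 * alpha ^ 4 * (Kk ^ 4 * jack_mean k (wide k)) * / v ^ 2) by (field; lra).
      apply Rmult_le_compat_r; [lra|]. unfold a5. apply Rmult_le_compat_l; [lra|].
      (* [wide_rare] starts at size 1; at size 0 the factor [Kk ^ 4] vanishes. *)
      destruct k as [|k].
      - unfold Kk. simpl. lra.
      - specialize (Hw (S k) ltac:(lia)). fold Kk in Hw.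
        assert (0 < Kk) by (apply lt_0_INR; lia). assert (0 < Kk ^ 4) by now apply pow_lt.
        replace c with (Kk ^ 4 * (c / Kk ^ 4)) by (field; lra).
        apply Rmult_le_compat_l; lra. }
    set (X := Kk / (v * sqrt v)) in *.
    assert (0 <= X) by (apply Rmult_le_pos; [easy|left; now apply Rinv_0_lt_compat]).
    set (Em := jack_mean k (fun lam => env _)) in *.
    assert (0 <= Em).
    { unfold Em. rewrite <- (jack_mean_const k 0). apply jack_mean_le. intros. left. apply env_pos. }
    assert (0 <= Kk ^ 2 / v ^ 2 * Em).
    { apply Rmult_le_pos; [|easy]. apply Rmult_le_pos; [apply pow2_ge_0|lra]. }
    replace (a4 * Kk ^ 2 / v ^ 2 * Em) with (a4 * (Kk ^ 2 / v ^ 2 * Em)) by (field; lra).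
    set (Y := Kk ^ 2 / v ^ 2 * Em) in *. set (Z := / v ^ 2) in *.
    assert (0 <= a3 * Y) by nra. assert (0 <= a3 * Z) by nra.
    assert (0 <= a4 * X) by nra. assert (0 <= a4 * Z) by nra.
    assert (0 <= a5 * X) by nra. assert (0 <= a5 * Y) by nra. lra.
Qed.

(** Compares 1 / x^2 with 1 / (x - 1) - 1 / x. The decay of the bound in [a] is the gain that closes
    the induction. *)
Lemma inv_sqr_sum (a : R) (n : nat) : 2 <= a ->
  lsum (seq 0 n) (fun k => / (INR (n - S k) + a) ^ 2) <= / (a - 1).
Proof.
  intros Ha.
  apply Rle_trans with (lsum (seq 0 n) (fun k => / (INR (n - S k) + a - 1) - / (INR (n - k) + a - 1))).
  - apply lsum_le. intros k Hk. apply in_seq in Hk.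
    replace (n - k)%nat with (S (n - S k)) by lia. rewrite S_INR.
    pose proof (pos_INR (n - S k)). set (x := INR (n - S k)) in *.
    replace (/ (x + a - 1) - / (x + 1 + a - 1)) with (/ ((x + a - 1) * (x + a))) by (field; lra).
    apply Rinv_le_contravar; nra.
  - rewrite (lsum_telescope n (fun k => / (INR (n - k) + a - 1))).
    rewrite Nat.sub_diag, Nat.sub_0_r. pose proof (pos_INR n). simpl (INR 0).
    replace (0 + a - 1) with (a - 1) by ring.
    assert (0 < / (INR n + a - 1)) by (apply Rinv_0_lt_compat; lra). lra.
Qed.

(** Compares x^(-3/2) with 2 / sqrt (x - 1) - 2 / sqrt x. *)
Lemma inv_three_halves_sum (a : R) (n : nat) : 2 <= a ->
  lsum (seq 0 n) (fun k => / ((INR (n - S k) + a) * sqrt (INR (n - S k) + a))) <= 2.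
Proof.
  intros Ha.
  apply Rle_trans with
    (lsum (seq 0 n) (fun k => 2 / sqrt (INR (n - S k) + a - 1) - 2 / sqrt (INR (n - k) + a - 1))).
  - apply lsum_le. intros k Hk. apply in_seq in Hk.
    replace (n - k)%nat with (S (n - S k)) by lia. rewrite S_INR.
    pose proof (pos_INR (n - S k)). set (x := INR (n - S k)) in *.
    replace (x + 1 + a - 1) with (x + a) by ring.
    pose proof (sqrt_lt_R0 (x + a - 1) ltac:(lra)) as Hp.
    assert (Hpq : sqrt (x + a - 1) <= sqrt (x + a)) by (apply sqrt_le_1_alt; lra).
    pose proof (sqrt_sqrt (x + a - 1) ltac:(lra)) as P2. pose proof (sqrt_sqrt (x + a) ltac:(lra)) as Q2.
    set (p := sqrt (x + a - 1)) in *. set (q := sqrt (x + a)) in *.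
    replace (2 / p - 2 / q) with (2 / (p * q * (p + q))).
    2:{ assert (E : (q - p) * (q + p) = 1) by nra.
        replace (2 / p - 2 / q) with (2 * ((q - p) * (q + p)) / (p * q * (p + q))) by (field; lra).
        now rewrite E, Rmult_1_r. }
    rewrite <- Q2.
    replace (/ (q * q * q)) with (2 / (q * q * (q + q))) by (field; lra).
    apply Rmult_le_compat_l; [lra|]. apply Rinv_le_contravar.
    + repeat apply Rmult_lt_0_compat; lra.
    + apply Rmult_le_compat; nra.
  - rewrite (lsum_telescope n (fun k => 2 / sqrt (INR (n - k) + a - 1))).
    rewrite Nat.sub_diag, Nat.sub_0_r. pose proof (pos_INR n). simpl (INR 0).
    assert (0 < 2 / sqrt (INR n + a - 1)) by (apply Rdiv_lt_0_compat; [lra|apply sqrt_lt_R0; lra]).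
    assert (2 / sqrt (0 + a - 1) <= 2 / 1).
    { apply Rmult_le_compat_l; [lra|]. apply Rinv_le_contravar; [lra|].
      rewrite <- sqrt_1 at 1. apply sqrt_le_1_alt. lra. }
    lra.
Qed.

(* Lindeberg telescoping along the growth process. Each jump is compensated by the heat flow; the
   error made at step [k] involves the local concentration at scale [sqrt v], which the induction
   hypothesis for [k] controls. The factor gained from the smoothing level [N] closes the induction. *)
Lemma smooth_berry_esseen : exists N K, 0 < N /\ 0 < K /\ forall (n : nat) (t y : R),
  (1 <= n)%nat -> 0 < t -> N * INR n <= t ^ 2 ->
  Rabs (smooth_cdf n t y - limit_cdf n t y) <= K / sqrt (INR n).
Proof.
  destruct jump_step as (C & HC & Hstep). pose proof env_const_pos as He.
  (* [C1] collects the errors free of K, [C2] the factor in front of K. *)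
  set (C1 := C * (2 + 8 * env_const)). set (C2 := 2 * C * env_const).
  assert (HC1 : 0 < C1) by (unfold C1; nra). assert (HC2 : 0 < C2) by (unfold C2; nra).
  assert (A3 : 1 <= alpha ^ 3) by now apply pow_R1_Rle.
  (* The first summand meets the condition of [jump_step], [alpha + 1] keeps the total variance of
     order n^2 in [Q], and [4 * C2] makes the contribution of K at most half of K. The choice of [K]
     makes the remaining 8 C1 the other half. *)
  set (N := 81 * alpha ^ 3 + alpha + 1 + 4 * C2). set (K := 16 * C1).
  exists N, K. assert (HN : 1 <= N) by (unfold N; lra). assert (HK : 0 < K) by (unfold K; lra).
  split; [lra|]. split; [easy|].
  induction n as [n IH] using (well_founded_induction lt_wf). intros t y Hn Ht Htn.
  assert (N1 : 1 <= INR n) by (apply (le_INR 1); lia).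
  (* [V k] is the variance of the jumps after step k, already Gaussian, plus the smoothing. [A]
     interpolates from the limit at 0 to the smoothed law at n. *)
  set (V := fun k : nat => alpha * binom2 n - alpha * binom2 k + t ^ 2).
  set (A := fun k : nat => jack_mean k (fun lam => Phi ((y - content_sum lam) / sqrt (V k)))).
  assert (EA : smooth_cdf n t y - limit_cdf n t y = A n - A 0%nat).
  { unfold smooth_cdf, limit_cdf, A, V. f_equal.
    - replace (alpha * binom2 n - alpha * binom2 n + t ^ 2) with (t ^ 2) by ring.
      rewrite sqrt_pow2 by lra. reflexivity.
    - rewrite (jack_mean_ext 0 _ (fun _ => Phi (y / sqrt (alpha * binom2 n + t ^ 2)))).
      + now rewrite jack_mean_const.
      + intros [|r mu] P E; [|simpl in *; lia]. simpl content_sum. f_equal. f_equal; [ring|].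
        f_equal. unfold binom2 at 2. simpl. field. }
  rewrite EA, <- lsum_telescope.
  apply Rle_trans with (1 := lsum_Rabs _ _).
  assert (Hsn : 0 < sqrt (INR n)) by (apply sqrt_lt_R0; lra).
  assert (Hsn2 : sqrt (INR n) * sqrt (INR n) = INR n) by (apply sqrt_sqrt; lra).
  set (s := sqrt (INR n)) in *.
  apply Rle_trans with (lsum (seq 0 n) (fun k =>
     (4 * C1 / s) * / ((INR (n - S k) + 2 * N) * sqrt (INR (n - S k) + 2 * N))
     + (4 * C2 * K / s) * / (INR (n - S k) + 2 * N) ^ 2)).
  - apply lsum_le. intros k Hk. apply in_seq in Hk.
    assert (Hkn : INR k <= INR n) by (apply le_INR; lia).
    pose proof (pos_INR k) as Hk0. pose proof (pos_INR (n - S k)) as Hj.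
    assert (Ej : INR n = INR (n - S k) + INR k + 1).
    { replace n with ((n - S k) + S k)%nat at 1 by lia. rewrite plus_INR, S_INR. ring. }
    set (j := INR (n - S k)) in *. set (x := j + 2 * N).
    assert (Hx : 2 <= x) by (unfold x; lra).
    set (v := V (S k)).
    assert (EV : V k = v + alpha * INR k) by (unfold v, V; rewrite binom2_S; ring).
    (* The variance of the remaining jumps is alpha j (n + k) / 2 >= j n / 2, and the smoothing
       contributes at least N n. *)
    assert (Hv : INR n * x / 2 <= v).
    { unfold v, V. rewrite binom2_S. unfold binom2, x.
      replace (alpha * (INR n * (INR n - 1) / 2) - alpha * (INR k * (INR k - 1) / 2 + INR k) + t ^ 2)
        with (alpha * (j * (INR n + INR k)) / 2 + t ^ 2) by (rewrite Ej; field).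
      assert (0 <= j * INR k) by nra. assert (0 <= j * INR n) by nra. nra. }
    assert (Hv' : N * INR n <= v) by (unfold x in Hv; nra).
    assert (Hv1 : 1 <= v) by nra. assert (Hv0 : 0 < v) by lra.
    unfold A. rewrite EV. fold v.
    eapply Rle_trans; [apply Hstep; [easy|unfold N in Hv'; nra]|].
    set (r := sqrt v). assert (Hr : 0 < r) by now apply sqrt_lt_R0.
    assert (Hr2 : r * r = v) by (apply sqrt_sqrt; lra).
    assert (Hr1 : 1 <= r) by (unfold r; rewrite <- sqrt_1; now apply sqrt_le_1_alt).
    assert (V2 : 0 < v ^ 2) by now apply pow_lt.
    assert (iV2 : 0 < / v ^ 2) by now apply Rinv_0_lt_compat.
    assert (Hvr : 0 < v * r) by nra.
    assert (iVr : 0 < / (v * r)) by now apply Rinv_0_lt_compat.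
    set (Em := jack_mean k _).
    assert (HEm : INR k ^ 2 / v ^ 2 * Em
       <= 8 * env_const * (INR n / (v * r)) + 2 * env_const * K * (INR n * s / v ^ 2)).
    { assert (R0 : 0 <= 8 * env_const * (INR n / (v * r)) + 2 * env_const * K * (INR n * s / v ^ 2)).
      { assert (0 <= INR n / (v * r)) by (apply Rmult_le_pos; lra).
        assert (0 <= INR n * s / v ^ 2) by (apply Rmult_le_pos; nra).
        assert (0 <= env_const * K) by nra. nra. }
      (* The induction hypothesis excludes k = 0, where the prefactor is 0. *)
      destruct k as [|k'].
      { simpl (INR 0). unfold Rdiv at 1. rewrite pow_i, !Rmult_0_l by lia. exact R0. }
      set (kk := S k') in *.
      assert (K1 : 1 <= INR kk) by (apply (le_INR 1); unfold kk; lia).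
      assert (Hsk : 0 < sqrt (INR kk)) by (apply sqrt_lt_R0; lra).
      assert (Hsk2 : sqrt (INR kk) * sqrt (INR kk) = INR kk) by (apply sqrt_sqrt; lra).
      assert (Hsks : sqrt (INR kk) <= s) by now apply sqrt_le_1_alt.
      set (sk := sqrt (INR kk)) in *.
      assert (B : Em <= env_const * (4 * r / sqrt (alpha * binom2 kk + (2 * r) ^ 2) + 2 * (K / sk))).
      (* The hypothesis is used at smoothing 2 r, admissible since 4 v >= N n >= N k. *)
      { apply env_mean_le; [easy|]. intros x'. apply IH; [lia|unfold kk; lia|lra|].
        replace ((2 * r) ^ 2) with (4 * v) by (rewrite <- Hr2; ring). nra. }
      (* The first k jumps and v together make up all of the variance of size n except for the k-th
         increment [alpha * INR kk], so the total is of order n^2 for every k. *)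
      assert (Q : INR n / 2 <= sqrt (alpha * binom2 kk + (2 * r) ^ 2)).
      { rewrite <- (sqrt_pow2 (INR n / 2)) by lra. apply sqrt_le_1_alt.
        replace ((2 * r) ^ 2) with (4 * v) by (rewrite <- Hr2; ring).
        assert (v <= 4 * v) by lra.
        assert (alpha * binom2 kk + v = alpha * binom2 n - alpha * INR kk + t ^ 2) as E1
          by (unfold v, V; rewrite binom2_S; ring).
        assert (INR n * (INR n - 1) / 2 <= alpha * binom2 n).
        { unfold binom2. assert (0 <= INR n * (INR n - 1) / 2) by nra. nra. }
        assert (alpha * INR kk <= alpha * INR n) by nra.
        assert ((alpha + 1) * INR n <= t ^ 2) by (unfold N in Htn; nra). nra. }
      set (q := sqrt (alpha * binom2 kk + (2 * r) ^ 2)) in *.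
      assert (Q2 : 4 * r / q <= 8 * r / INR n).
      { replace (8 * r / INR n) with (4 * r * / (INR n / 2)) by (field; lra).
        apply Rmult_le_compat_l; [lra|]. apply Rinv_le_contravar; lra. }
      assert (P0 : 0 <= INR kk ^ 2 / v ^ 2) by (apply Rmult_le_pos; [apply pow2_ge_0|lra]).
      apply Rle_trans with (INR kk ^ 2 / v ^ 2 * (env_const * (8 * r / INR n + 2 * (K / sk)))).
      { apply Rmult_le_compat_l; [easy|]. apply Rle_trans with (1 := B).
        apply Rmult_le_compat_l; lra. }
      replace (INR kk ^ 2 / v ^ 2 * (env_const * (8 * r / INR n + 2 * (K / sk))))
        with (8 * env_const * (INR kk ^ 2 * r / (INR n * v ^ 2)) + 2 * env_const * K * (INR kk ^ 2 / sk / v ^ 2))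
        by (field; lra).
      apply Rplus_le_compat.
      - apply Rmult_le_compat_l; [lra|].
        replace (INR n / (v * r)) with (INR n ^ 2 * r / (INR n * v ^ 2)) by (rewrite <- Hr2; field; lra).
        apply Rmult_le_compat_r; [left; apply Rinv_0_lt_compat; nra|].
        apply Rmult_le_compat_r; [lra|]. apply pow_incr. lra.
      - apply Rmult_le_compat_l; [nra|]. apply Rmult_le_compat_r; [lra|].
        replace (INR kk ^ 2 / sk) with (INR kk * sk) by (rewrite <- Hsk2; field; lra).
        apply Rmult_le_compat; lra. }
    assert (T1 : INR k / (v * r) <= INR n / (v * r)) by (apply Rmult_le_compat_r; lra).
    assert (T3 : / v ^ 2 <= INR n / (v * r)).
    { apply Rle_trans with (1 * / (v * r)); [rewrite Rmult_1_l; apply Rinv_le_contravar; nra|].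
      apply Rmult_le_compat_r; lra. }
    apply Rle_trans with (C1 * (INR n / (v * r)) + C2 * K * (INR n * s / v ^ 2)).
    { unfold C1, C2. set (X := INR n / (v * r)) in *. set (Y := INR n * s / v ^ 2) in *.
      apply Rle_trans with (C * (X + (8 * env_const * X + 2 * env_const * K * Y) + X)); [|right; ring].
      apply Rmult_le_compat_l; lra. }
    assert (Hsx : 0 < sqrt x) by (apply sqrt_lt_R0; lra).
    assert (Hsx2 : sqrt x * sqrt x = x) by (apply sqrt_sqrt; lra).
    assert (Hrx : s * sqrt x / 2 <= r).
    { unfold s, r. rewrite <- sqrt_mult by lra.
      replace (sqrt (INR n * x) / 2) with (sqrt (INR n * x / 4)).
      - apply sqrt_le_1_alt. nra.
      - replace (INR n * x / 4) with (INR n * x / 2 ^ 2) by field.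
        rewrite sqrt_div by nra. now rewrite sqrt_pow2 by lra. }
    assert (Hnx : 0 < INR n * x) by nra. assert (Hss : 0 < s * sqrt x) by nra.
    apply Rplus_le_compat.
    + replace (4 * C1 / s * / (x * sqrt x)) with (C1 * (INR n / ((INR n * x / 2) * (s * sqrt x / 2))))
        by (field; lra).
      apply Rmult_le_compat_l; [lra|]. apply Rmult_le_compat_l; [lra|].
      apply Rinv_le_contravar; [apply Rmult_lt_0_compat; lra|]. apply Rmult_le_compat; lra.
    + replace (4 * C2 * K / s * / x ^ 2) with (C2 * K * (INR n * s / (INR n * x / 2) ^ 2))
        by (rewrite <- Hsn2; field; lra).
      apply Rmult_le_compat_l; [nra|]. apply Rmult_le_compat_l; [nra|].
      apply Rinv_le_contravar; [apply pow_lt; lra|]. apply pow_incr. lra.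
  - rewrite lsum_plus, !lsum_scal.
    pose proof (inv_three_halves_sum (2 * N) n ltac:(lra)) as S1.
    pose proof (inv_sqr_sum (2 * N) n ltac:(lra)) as S2.
    assert (S2' : / (2 * N - 1) <= / (8 * C2)) by (apply Rinv_le_contravar; unfold N; lra).
    assert (0 < / s) by now apply Rinv_0_lt_compat.
    apply Rle_trans with (4 * C1 / s * 2 + 4 * C2 * K / s * / (8 * C2)).
    + assert (0 < C2 * K) by nra.
      apply Rplus_le_compat; (apply Rmult_le_compat_l; [apply Rmult_le_pos; lra|lra]).
    + right. unfold K. field. lra.
Qed.

(** * Removing the smoothing *)

Lemma Phi_var_lipschitz (w v d : R) : 0 < v -> 0 <= d ->
  Rabs (Phi (w / sqrt (v + d)) - Phi (w / sqrt v)) <= d / (2 * v).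
Proof.
  intros Hv Hd.
  destruct (MVT_gen (fun u => Phi (w / sqrt u)) v (v + d) (fun u => Phi2 (w / sqrt u) / (2 * u)))
    as (c & Hc & E).
  - rewrite Rmin_left by lra. intros u Hu. apply is_derive_Phi_var. lra.
  - rewrite Rmin_left by lra. intros u Hu. apply derivable_continuous_pt. eexists.
    apply is_derive_Reals, is_derive_Phi_var. lra.
  - rewrite Rmin_left, Rmax_right in Hc by lra. rewrite E.
    replace (v + d - v) with d by ring. unfold Rdiv. rewrite !Rabs_mult.
    rewrite (Rabs_pos_eq d) by easy.
    assert (0 < / (2 * c) <= / (2 * v)).
    { split; [apply Rinv_0_lt_compat; lra|]. apply Rinv_le_contravar; lra. }
    rewrite (Rabs_pos_eq (/ (2 * c))) by lra.
    pose proof (Phi2_bound (w / sqrt c)). pose proof (Rabs_pos (Phi2 (w / sqrt c))).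
    rewrite Rmult_comm. apply Rmult_le_compat_l; [easy|]. nra.
Qed.

Lemma indicator_vs_Phi (x y t : R) : 0 < t ->
  Rabs ((if Rle_dec x y then 1 else 0) - Phi ((y - x) / t)) <= 2 * env ((y - x) / t).
Proof.
  intros Ht. assert (Hi : 0 < / t) by now apply Rinv_0_lt_compat. destruct (Rle_dec x y).
  - destruct (Phi_tail_env ((y - x) / t)); [apply Rmult_le_pos; lra|]. rewrite Rabs_pos_eq; lra.
  - destruct (Phi_tail_env (- ((y - x) / t))) as [H1 H2].
    { unfold Rdiv. rewrite Ropp_mult_distr_l. apply Rmult_le_pos; lra. }
    rewrite Phi_opp in H1, H2. rewrite env_opp in H2.
    apply Rabs_le. lra.
Qed.

Lemma jack_prob_T_le_mean (n : nat) (x0 : R) : 0 < alpha * binom2 n ->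
  jack_prob_T_le alpha n x0
  = jack_mean n (fun lam => if Rle_dec (content_sum lam) (x0 * sqrt (alpha * binom2 n)) then 1 else 0).
Proof.
  intros Hv. pose proof (sqrt_lt_R0 _ Hv) as Hs.
  unfold jack_prob_T_le, jack_mean. apply lsum_ext. intros lam Hl. apply in_partitions in Hl as [P _].
  unfold T_stat. rewrite <- (content_sum_conjugate n) by easy. set (s := sqrt _) in *.
  destruct (Rle_dec (content_sum lam / s) x0) as [H|H], (Rle_dec (content_sum lam) (x0 * s)) as [H'|H'];
    try ring; exfalso.
  - apply H'. replace (content_sum lam) with (content_sum lam / s * s) by (field; lra).
    apply Rmult_le_compat_r; lra.
  - apply H. replace x0 with (x0 * s * / s) by (field; lra).
    apply Rmult_le_compat_r; [left; now apply Rinv_0_lt_compat|easy].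
Qed.

Lemma jack_berry_esseen : exists C, forall (n : nat) (x0 : R), (2 <= n)%nat ->
  Rabs (jack_prob_T_le alpha n x0 - Phi x0) <= C / sqrt (INR n).
Proof.
  destruct smooth_berry_esseen as (N & K & HN & HK & H). pose proof env_const_pos as He.
  exists (2 * env_const * (8 * sqrt N + 2 * K) + K + 2 * N). intros n x0 Hn.
  assert (N2 : 2 <= INR n) by (apply (le_INR 2); lia).
  assert (Hvar : INR n ^ 2 / 4 <= alpha * binom2 n).
  { unfold binom2. assert (INR n ^ 2 / 4 <= INR n * (INR n - 1) / 2) by nra. nra. }
  set (v := alpha * binom2 n) in *. assert (Hv0 : 0 < v) by nra.
  assert (Hsv : INR n / 2 <= sqrt v).
  { rewrite <- (sqrt_pow2 (INR n / 2)) by lra. apply sqrt_le_1_alt. lra. }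
  assert (Hs : 0 < sqrt (INR n)) by (apply sqrt_lt_R0; lra).
  assert (Hs2 : sqrt (INR n) * sqrt (INR n) = INR n) by (apply sqrt_sqrt; lra).
  rewrite jack_prob_T_le_mean by easy. fold v.
  set (y := x0 * sqrt v). set (s := sqrt (INR n)) in *.
  (* The least smoothing that [smooth_berry_esseen] admits; relative to sqrt v it is of order
     n^(-1/2). *)
  set (t := sqrt N * s).
  assert (HsN : 0 < sqrt N) by now apply sqrt_lt_R0.
  assert (Ht : 0 < t) by (unfold t; nra).
  assert (Ht2 : t ^ 2 = N * INR n).
  { unfold t. rewrite <- Hs2. replace ((sqrt N * s) ^ 2) with (sqrt N * sqrt N * (s * s)) by ring.
    now rewrite sqrt_sqrt by lra. }
  (* Replacing the indicator costs the concentration of the content sum at scale t, which the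
     smoothed theorem at 2 t provides. *)
  assert (E1 : Rabs (jack_mean n (fun lam => if Rle_dec (content_sum lam) y then 1 else 0) - smooth_cdf n t y)
                <= 2 * (env_const * (8 * sqrt N / s + 2 * (K / s)))).
  { unfold smooth_cdf. rewrite <- jack_mean_minus. apply Rle_trans with (1 := jack_mean_Rabs _ _).
    apply Rle_trans with (jack_mean n (fun lam => 2 * env ((y - content_sum lam) / t))).
    - apply jack_mean_le. intros lam _ _. now apply indicator_vs_Phi.
    - rewrite jack_mean_scal. apply Rmult_le_compat_l; [lra|].
      eapply Rle_trans; [apply (env_mean_le n t y (K / s) Ht)|].
      + intros x. apply H; [lia|lra|]. nra.
      + apply Rmult_le_compat_l; [lra|]. apply Rplus_le_compat_r.
        fold v. assert (Q : INR n / 2 <= sqrt (v + (2 * t) ^ 2)).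
        { apply Rle_trans with (1 := Hsv). apply sqrt_le_1_alt. nra. }
        replace (8 * sqrt N / s) with (4 * t * / (INR n / 2)) by (unfold t; rewrite <- Hs2; field; lra).
        apply Rmult_le_compat_l; [lra|]. apply Rinv_le_contravar; lra. }
  assert (E2 := H n t y ltac:(lia) Ht ltac:(lra)). fold s in E2. unfold limit_cdf in E2. fold v in E2.
  (* Dropping t^2 = N n from a variance of order n^2 costs only order 1 / n. *)
  assert (E3 : Rabs (Phi (y / sqrt (v + t ^ 2)) - Phi (y / sqrt v)) <= 2 * N / s).
  { eapply Rle_trans; [apply Phi_var_lipschitz; [easy|nra]|]. rewrite Ht2.
    apply Rle_trans with (N * INR n / (INR n ^ 2 / 2)).
    - apply Rmult_le_compat_l; [nra|]. apply Rinv_le_contravar; nra.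
    - replace (N * INR n / (INR n ^ 2 / 2)) with (2 * N * / INR n) by (field; lra).
      apply Rmult_le_compat_l; [lra|]. apply Rinv_le_contravar; [easy|].
      assert (1 <= s) by (unfold s; rewrite <- sqrt_1; apply sqrt_le_1_alt; lra). nra. }
  replace (y / sqrt v) with x0 in E3 by (unfold y; field; lra).
  replace ((2 * env_const * (8 * sqrt N + 2 * K) + K + 2 * N) / s)
    with (2 * (env_const * (8 * sqrt N / s + 2 * (K / s))) + K / s + 2 * N / s) by (field; lra).
  apply Rabs_le_between in E1. apply Rabs_le_between in E2. apply Rabs_le_between in E3.
  apply Rabs_le_between. lra.
Qed.

End Jack.

Theorem theorem2 (alpha : R) (halpha : 1 <= alpha) :
  exists C : R, forall (n : nat) (x0 : R), (2 <= n)%nat ->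
    Rabs (jack_prob_T_le alpha n x0 - std_normal_cdf x0) <= C / sqrt (INR n).
Proof.
  destruct (jack_berry_esseen alpha halpha) as [C H]. exists C. intros n x0 Hn.
  rewrite std_normal_cdf_Phi. now apply H.
Qed.
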